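(* Let $M$ be an oriented four-manifold, $g$ a Lorentzian metric on $M$, and $\mathcal{D}=(\Sigma,\Xi)$ a scalar-electromagnetic structure with $\Sigma=(\mathcal{M},\mathcal{G},\Phi)$ and $\Xi=(\mathcal{S},D,J,\omega)$. Then for all $f\in\mathrm{Aut}(\mathcal{D})$ we have $$f\diamond \mathrm{Sol}^g_{\mathcal{D}}(M)=\mathrm{Sol}^g_{\mathcal{D}}(M).$$ Thus $\mathrm{Aut}(\mathcal{D})$ consists of symmetries of the scalar-electromagnetic equations of motion, for any fixed Lorentzian metric $g$.
   Context: All manifolds are smooth, connected, Hausdorff and paracompact; bundles, sections and maps are smooth. Lorentzian means signature $(3,1)$ (mostly plus). Structures. A scalar structure $\Sigma=(\mathcal{M},\mathcal{G},\Phi)$ is a Riemannian manifold $(\mathcal{M},\mathcal{G})$ with $\Phi\in C^\infty(\mathcal{M},\mathbb{R})$; $\mathrm{Aut}(\Sigma)$ is the group of isometries $\psi$ of $(\mathcal{M},\mathcal{G})$ with $\Phi\circ\psi=\Phi$. A duality structure $\Delta=(\mathcal{S},D,\omega)$ on $\mathcal{M}$ is a real vector bundle $\mathcal{S}$ with a fiberwise symplectic pairing $\omega$ and a flat connection $D$ compatible with $\omega$: $X(\omega(\xi_1,\xi_2))=\omega(D_X\xi_1,\xi_2)+\omega(\xi_1,D_X\xi_2)$. A taming $J$ of $(\mathcal{S},\omega)$ is $J\in\Gamma(\mathcal{M},End(\mathcal{S}))$ with $J^2=-\mathrm{id}$, $\omega(J\xi_1,J\xi_2)=\omega(\xi_1,\xi_2)$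 and $Q_{J,\omega}(\xi_1,\xi_2):=\omega(J\xi_1,\xi_2)$ positive-definite; $J$ need not be $D$-parallel. $\Xi=(\mathcal{S},D,J,\omega)$ is then an electromagnetic structure, and $\mathcal{D}=(\Sigma,\Xi)$ a scalar-electromagnetic structure. Fundamental field. $\Theta_\Xi\in\Omega^1(\mathcal{M},End(\mathcal{S}))$ is $\Theta_\Xi(X)=D_X\circ J-J\circ D_X$, and $\Psi_{\mathcal{D}}:=(\sharp_{\mathcal{G}}\otimes\mathrm{id})(\Theta_\Xi)\in\Gamma(\mathcal{M},T\mathcal{M}\otimes End(\mathcal{S}))$, where $\sharp_{\mathcal{G}}:T^*\mathcal{M}\to T\mathcal{M}$ is the musical isomorphism. Configurations and solutions. A superscript $\varphi$ denotes pull-back of bundles, sections and connections along $\varphi:M\to\mathcal{M}$. $\mathrm{Conf}^g_{\mathcal{D}}(M)$ is the set of pairs $(\varphi,\mathcal{V})$ with $\varphi\in C^\infty(M,\mathcal{M})$ and $\mathcal{V}\in\Omega^2(M,\mathcal{S}^\varphi)$ satisfying $\ast_g\mathcal{V}=-J^\varphi\mathcal{V}$, where the Hodge operator $\ast_g$ of $(M,g)$ acts on the form factor. $\mathrm{Sol}^g_{\mathcal{D}}(M)$ is the subset of those pairs satisfying the scalar-electromagnetic equations (i) $\theta_\Sigma(g,\varphi)-\tfrac12(\ast_g\mathcal{V},\Psi_{\mathcal{D}}^\varphi\mathcal{V})=0$, (ii) $\mathrm{d}_{D^\varphi}\mathcal{V}=0$, where $\mathrm{d}_{D^\varphi}$ is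 the exterior differential twisted by $D^\varphi$; $\theta_\Sigma(g,\varphi):=\mathrm{Tr}_g\nabla \mathrm{d}\varphi-(\mathrm{grad}_{\mathcal{G}}\Phi)^\varphi\in\Gamma(M,(T\mathcal{M})^\varphi)$ with $\nabla$ the connection on $T^*M\otimes(T\mathcal{M})^\varphi$ induced by the Levi-Civita connections of $g$ and $\mathcal{G}$; and $(\cdot,\cdot)$ is the pairing on $\wedge T^*M\otimes\mathcal{S}^\varphi$ with $(\rho_1\otimes\xi_1,\rho_2\otimes\xi_2)=(\rho_1,\rho_2)_g\,Q_{J,\omega}^\varphi(\xi_1,\xi_2)$, where $(\cdot,\cdot)_g$ is induced by $g$ on $\wedge T^*M$, trivially extended so that a factor in $(T\mathcal{M})^\varphi$ is carried along as a spectator. Symmetries. An unbased automorphism $f$ of $\mathcal{S}$ is a diffeomorphism $f:\mathcal{S}\to\mathcal{S}$ covering a diffeomorphism $f_0$ of $\mathcal{M}$ with linear fiber maps $f_p:\mathcal{S}_p\to\mathcal{S}_{f_0(p)}$. $\mathrm{Aut}^{ub}(\Xi)$ is the group of unbased automorphisms that are symplectic (each $f_p$ is a symplectic isomorphism $(\mathcal{S}_p,\omega_p)\to(\mathcal{S}_{f_0(p)},\omega_{f_0(p)})$), complex ($f_p\circ J_p=J_{f_0(p)}\circ f_p$ for all $p$) and covariantly constant ($D_{(f_0)_*X}\,\mathbf{f}(\xi)=\mathbf{f}(D_X\xi)$ for all $X,\xi$, where $\mathbf{f}(\xi)=f\circ\xi\circ f_0^{-1}$). The scalar-electromagnetic symmetry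 group is $\mathrm{Aut}(\mathcal{D}):=\{f\in\mathrm{Aut}^{ub}(\Xi)\mid f_0\in\mathrm{Aut}(\Sigma)\}$. It acts by $f\diamond(\varphi,\mathcal{V}):=(f_0\circ\varphi,\hat f^\varphi(\mathcal{V}))$, where $\hat f:\mathcal{S}\to\mathcal{S}^{f_0}$ is the based bundle isomorphism with $\hat f_p=f_p$, and $\hat f^\varphi:\mathcal{S}^\varphi\to\mathcal{S}^{f_0\circ\varphi}$ is its pull-back, acting trivially on the form factor. *)

(* Defs.v *)
From HB Require Import structures.
From mathcomp Require Import all_boot all_order all_algebra.
From mathcomp Require Import boolp classical_sets functions cardinality.
From mathcomp Require Import reals topology normedtype derive landau.

Set Implicit Arguments.
Unset Strict Implicit.
Unset Printing Implicit Defensive.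

Import Order.TTheory GRing.Theory Num.Theory.
Import numFieldNormedType.Exports.

Local Open Scope classical_set_scope.
Local Open Scope ring_scope.

Section SmoothCalculus.
Variables (R : realType) (V W : normedModType R).

Fixpoint Ck (k : nat) (U : set V) (f : V -> W) : Prop :=
  if k is k'.+1 then
    (forall x, U x -> differentiable f x) /\
    (forall v : V, Ck k' U (fun x => 'd f x v))
  else forall x, U x -> {for x, continuous f}.

Definition smooth_on (U : set V) (f : V -> W) : Prop := forall k, Ck k U f.

Definition smooth_near (x : V) (f : V -> W) : Prop :=
  exists U : set V, [/\ open U, U x & smooth_on U f].

Lemma near_eq_is_diff (f h : V -> W) (x : V) :
  (\forall y \near x, f y = h y) -> differentiable f x ->
  differentiable h x /\ 'd f x = 'd h x :> (V -> W).
Proof.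
move=> fh df.
have fhx : f x = h x by exact: nbhs_singleton fh.
have := df => /diff_locallyP[dc /eqaddoP dE].
have dhE : h \o shift x = cst (h x) + 'd f x +o_ 0 id.
  apply/eqaddoP => e e0; have := dE e e0.
  move/nbhs0P : fh; apply: filterS2 => y /= fhy.
  by rewrite addrC in fhy; rewrite !fctE fhy fhx.
have dfh := diff_unique dc dhE.
split; last exact: esym dfh.
apply: (iffRL (diff_locallyP x h)); rewrite dfh; exact: (conj dc dhE).
Qed.

Lemma eq_Ck (k : nat) (U : set V) (f h : V -> W) : open U ->
  (forall x, U x -> f x = h x) -> Ck k U f -> Ck k U h.
Proof.
move=> oU; elim: k f h => [|k IH] f h fh /=.
  move=> cf x Ux; have fhx : \forall y \near x, f y = h y.
    by apply: filterS (open_nbhs_nbhs (conj oU Ux)) => y /fh.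
  rewrite /prop_for /continuous_at -(fh x Ux).
  by apply: cvg_trans (cf x Ux); apply: near_eq_cvg.
have E x : U x -> \forall y \near x, f y = h y.
  by move=> Ux; apply: filterS (open_nbhs_nbhs (conj oU Ux)) => y /fh.
move=> [df cf]; split=> [x Ux|v].
  exact: (near_eq_is_diff (E x Ux) (df x Ux)).1.
apply: IH (cf v) => x Ux.
by rewrite (near_eq_is_diff (E x Ux) (df x Ux)).2.
Qed.

End SmoothCalculus.

Section Manifolds.
Variable R : realType.

(* Local charts are total maps that are only meaningful on [cdom] and on its
   image; their values elsewhere are unconstrained. *)
Record chart (T : topologicalType) (n : nat) := Chart {
  cdom : set T;
  cmap :> T -> 'rV[R]_n;
  cinv : 'rV[R]_n -> T }.

Definition is_chart (T : topologicalType) (n : nat) (c : chart T n) : Prop :=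
  [/\ open (cdom c), open (c @` cdom c),
      forall p, cdom c p -> cinv c (c p) = p,
      forall p, cdom c p -> {for p, continuous c} &
      forall u, (c @` cdom c) u -> {for u, continuous (cinv c)}].

Definition smooth_transition (T : topologicalType) (n : nat)
    (c d : chart T n) : Prop :=
  smooth_on (c @` (cdom c `&` cdom d)) (d \o cinv c).

Definition open_cover (T : topologicalType) (C : set (set T)) : Prop :=
  (forall A, C A -> open A) /\ (forall x, exists2 A, C A & A x).

Definition paracompact (T : topologicalType) : Prop :=
  forall C : set (set T), open_cover C ->
  exists D : set (set T),
    [/\ open_cover D,
        forall B, D B -> exists2 A, C A & B `<=` A &
        forall x : T, exists2 U, nbhs x U &
          finite_set [set B | D B /\ B `&` U !=set0]].

Record manifold (n : nat) := Manifold {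
  mpoint :> topologicalType;
  atlas : set (chart mpoint n);
  mfd_hausdorff : hausdorff_space mpoint;
  mfd_paracompact : paracompact mpoint;
  mfd_connected : connected [set: mpoint];
  atlas_chart : forall c, atlas c -> is_chart c;
  atlas_cover : forall p : mpoint, exists c, atlas c /\ cdom c p;
  atlas_compat : forall c d, atlas c -> atlas d -> smooth_transition c d;
  atlas_max : forall c, is_chart c ->
    (forall d, atlas d -> smooth_transition c d /\ smooth_transition d c) ->
    atlas c }.

Arguments atlas {n} m _.

Definition chart_at (n : nat) (N : manifold n) (p : N) : chart N n :=
  sval (cid (atlas_cover p)).

Lemma chart_at_atlas (n : nat) (N : manifold n) (p : N) :
  atlas N (chart_at p).
Proof. exact: (svalP (cid (atlas_cover p))).1. Qed.

Lemma chart_at_dom (n : nat) (N : manifold n) (p : N) : cdom (chart_at p) p.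
Proof. exact: (svalP (cid (atlas_cover p))).2. Qed.

Definition smooth_at (n : nat) (N : manifold n) (W : normedModType R)
    (p : N) (h : N -> W) : Prop :=
  exists c, [/\ atlas N c, cdom c p & smooth_near (c p) (h \o cinv c)].

Definition smooth_map (m n : nat) (M : manifold m) (N : manifold n)
    (phi : M -> N) : Prop :=
  continuous phi /\
  forall c d, atlas M c -> atlas N d ->
    smooth_on (c @` (cdom c `&` phi @^-1` cdom d)) (d \o phi \o cinv c).

Definition diffeomorphism (m n : nat) (M : manifold m) (N : manifold n)
    (phi : M -> N) : Prop :=
  smooth_map phi /\
  exists psi : N -> M, [/\ cancel phi psi, cancel psi phi & smooth_map psi].

(* Derivative at [p] of the change of coordinates from [c] to [d]. *)
Definition dchange (n : nat) (N : manifold n) (c d : chart N n) (p : N) :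
  'rV[R]_n -> 'rV[R]_n := 'd (d \o cinv c) (c p).

Lemma open_overlap (n : nat) (N : manifold n) (c d : chart N n) :
  atlas N c -> atlas N d -> open (c @` (cdom c `&` cdom d)).
Proof.
move=> /atlas_chart[oc oic cK cc ccinv] /atlas_chart[od _ _ _ _].
rewrite openE => _ [p [cp dp] <-].
have icp : (c @` cdom c) (c p) by exists p.
have := ccinv _ icp; rewrite /prop_for /continuous_at (cK _ cp) => cv.
have := cv _ (open_nbhs_nbhs (conj od dp)).
have := open_nbhs_nbhs (conj oic icp).
apply: filterS2 => _ [q cq <-] /=; rewrite (cK _ cq) => dq.
by exists q.
Qed.

Lemma dchange_trans (n : nat) (N : manifold n) (c d e : chart N n) (p : N)
    (w : 'rV[R]_n) : atlas N c -> atlas N d -> atlas N e ->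
  cdom c p -> cdom d p -> cdom e p ->
  dchange d e p (dchange c d p w) = dchange c e p w.
Proof.
move=> ac ad ae cp dp ep.
have [_ _ cK _ _] := atlas_chart ac; have [_ _ dK _ _] := atlas_chart ad.
have [/(_ (c p)) D1 _] := atlas_compat ac ad 1.
have [/(_ (d p)) D2 _] := atlas_compat ad ae 1.
have {}D1 : differentiable (d \o cinv c) (c p) by apply: D1; exists p.
have dp_eq : (d \o cinv c) (c p) = d p := congr1 d (cK p cp).
have {}D2 : differentiable (e \o cinv d) ((d \o cinv c) (c p)).
  by rewrite dp_eq; apply: D2; exists p.
have chain := diff_comp D1 D2; rewrite dp_eq in chain.
apply: (etrans (congr1 (fun F : 'rV[R]_n -> 'rV[R]_n => F w) (esym chain))).
have E : \forall u \near c p,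
    ((e \o cinv d) \o (d \o cinv c)) u = (e \o cinv c) u.
  have : (c @` (cdom c `&` cdom d)) (c p) by exists p.
  move=> /(conj (open_overlap ac ad))/open_nbhs_nbhs; apply: filterS.
  by move=> _ [q [cq dq] <-] /=; rewrite (cK _ cq) dK.
have [_ DE] := near_eq_is_diff E (differentiable_comp D1 D2).
by have := congr1 (fun F : 'rV[R]_n -> 'rV[R]_n => F w) DE.
Qed.

Lemma dchange_id (n : nat) (N : manifold n) (c : chart N n) (p : N)
    (w : 'rV[R]_n) : atlas N c -> cdom c p -> dchange c c p w = w.
Proof.
move=> ac cp; have [_ oic cK _ _] := atlas_chart ac.
have E : \forall u \near c p, id u = (c \o cinv c) u.
  have : (c @` cdom c) (c p) by exists p.
  move=> /(conj oic)/open_nbhs_nbhs; apply: filterS.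
  by move=> _ [q cq <-] /=; rewrite cK.
have di : is_diff (c p) (id : 'rV[R]_n -> 'rV[R]_n) id := is_diff_id _.
have [_ DE] := near_eq_is_diff E (ex_diff (is_diff_def := di)).
have Did := diff_val (is_diff_def := di).
by have := congr1 (fun F : 'rV[R]_n -> 'rV[R]_n => F w) (etrans (esym DE) Did).
Qed.

Record trivialization (B : Type) (E : B -> lmodType R) (r : nat) := Triv {
  triv_dom : set B;
  triv_val : forall p, E p -> 'rV[R]_r;
  triv_inv : forall p, 'rV[R]_r -> E p }.

(* A vector bundle is given by its fibers and a (not necessarily maximal)
   smooth family of local trivializations; the topology and the smooth
   structure of the total space are the ones induced by these. *)
Record vbundle (n : nat) (N : manifold n) (r : nat) := VBundle {
  fiber :> N -> lmodType R;
  trivs : set (trivialization fiber r);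
  triv_open : forall t, trivs t -> open (triv_dom t);
  triv_cover : forall p, exists t, trivs t /\ triv_dom t p;
  triv_linear : forall t p, trivs t -> triv_dom t p -> linear (triv_val t (p := p));
  triv_valK : forall t p, trivs t -> triv_dom t p ->
    cancel (triv_val t (p := p)) (triv_inv t p);
  triv_invK : forall t p, trivs t -> triv_dom t p ->
    cancel (triv_inv t p) (triv_val t (p := p));
  triv_compat : forall s t p (w : 'rV[R]_r), trivs s -> trivs t ->
    triv_dom s p -> triv_dom t p -> smooth_at p (fun q => triv_val t (triv_inv s q w)) }.

Arguments trivs {n N r} v _.

Section Tangent.
Variables (n : nat) (N : manifold n).

(* A tangent vector at [p] is represented by its components in [chart_at p];
   its components in another chart are obtained by [dchange]. *)
Definition tangent_triv (c : chart N n) :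
    trivialization (fun _ : N => 'rV[R]_n : lmodType R) n :=
  @Triv N (fun _ => 'rV[R]_n : lmodType R) n (cdom c)
    (fun p v => dchange (chart_at p) c p v)
    (fun p w => dchange c (chart_at p) p w).

Lemma tangent_open t : (tangent_triv @` atlas N) t -> open (triv_dom t).
Proof. by move=> [c /atlas_chart[]] + _ _ _ _ <-. Qed.

Lemma tangent_cover p : exists t, (tangent_triv @` atlas N) t /\ triv_dom t p.
Proof.
by have [c [ac cp]] := atlas_cover p; exists (tangent_triv c); split=> //; exists c.
Qed.

Lemma tangent_linear t p : (tangent_triv @` atlas N) t -> triv_dom t p ->
  linear (triv_val t (p := p)).
Proof. by move=> [c ac <-] cp a v w; exact: linearP. Qed.

Lemma tangent_valK t p : (tangent_triv @` atlas N) t -> triv_dom t p ->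
  cancel (triv_val t (p := p)) (triv_inv t p).
Proof.
move=> [c ac <-] cp v /=.
have ap := chart_at_atlas p; have dp := chart_at_dom p.
by rewrite (dchange_trans _ ap ac ap) // dchange_id.
Qed.

Lemma tangent_invK t p : (tangent_triv @` atlas N) t -> triv_dom t p ->
  cancel (triv_inv t p) (triv_val t (p := p)).
Proof.
move=> [c ac <-] cp w /=.
have ap := chart_at_atlas p; have dp := chart_at_dom p.
by rewrite (dchange_trans _ ac ap ac) // dchange_id.
Qed.

Lemma tangent_compat s t p (w : 'rV[R]_n) : (tangent_triv @` atlas N) s ->
    (tangent_triv @` atlas N) t -> triv_dom s p -> triv_dom t p ->
  smooth_at p (fun q => triv_val t (triv_inv s q w)).
Proof.
move=> [c ac <-] [d ad <-] /= cp dp; exists c; split=> //.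
exists (c @` (cdom c `&` cdom d)); split; [exact: open_overlap|by exists p|].
move=> k; have [_ /(_ w)] := atlas_compat ac ad k.+1.
apply: eq_Ck; first exact: open_overlap.
move=> _ [q [cq dq] <-] /=; have [_ _ cK _ _] := atlas_chart ac; rewrite cK //.
by rewrite (dchange_trans w ac (chart_at_atlas q) ad cq (chart_at_dom q) dq).
Qed.

Definition tangent : vbundle N n :=
  VBundle tangent_open tangent_cover tangent_linear tangent_valK tangent_invK
    tangent_compat.

End Tangent.

Definition smooth_section_at (n : nat) (N : manifold n) (r : nat)
    (S : vbundle N r) (p : N) (xi : forall q, S q) : Prop :=
  exists t, [/\ trivs S t, triv_dom t p & smooth_at p (fun q => triv_val t (xi q))].

(* Smoothness at [x] of a section of the pull-back bundle [phi^* S]. *)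
Definition smooth_along_at (m n : nat) (M : manifold m) (N : manifold n)
    (phi : M -> N) (r : nat) (S : vbundle N r) (x : M)
    (sigma : forall y, S (phi y)) : Prop :=
  exists t, [/\ trivs S t, triv_dom t (phi x) &
    smooth_at x (fun y => triv_val t (sigma y))].

Definition smooth_real_at (n : nat) (N : manifold n) (p : N) (h : N -> R) : Prop :=
  smooth_at p (h : N -> R^o).

Definition vder (n : nat) (N : manifold n) (p : N) (v : tangent N p)
    (h : N -> R) : R :=
  'd ((h : N -> R^o) \o cinv (chart_at p)) (chart_at p p) v.

Definition dmap (m n : nat) (M : manifold m) (N : manifold n) (phi : M -> N)
    (x : M) (v : tangent M x) : tangent N (phi x) :=
  'd (chart_at (phi x) \o phi \o cinv (chart_at x)) (chart_at x x) v.

Section Connections.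
Variables (n : nat) (N : manifold n).

(* [z] is the value at [p] of the Lie bracket of [X] and [Y]. *)
Definition is_bracket (X Y : forall q, tangent N q) (p : N) (z : tangent N p) : Prop :=
  forall h : N -> R, smooth_real_at p h ->
    vder z h = vder (X p) (fun q => vder (Y q) h)
             - vder (Y p) (fun q => vder (X q) h).

(* Covariant derivatives are applied to sections that are smooth near the point
   of evaluation; nothing is required of their values on other sections. *)
Record connection (r : nat) (S : vbundle N r) := Connection {
  cov :> forall p, tangent N p -> (forall q, S q) -> S p;
  cov_linear : forall p xi, smooth_section_at p xi ->
    linear (fun v : tangent N p => cov v xi);
  cov_add : forall p (v : tangent N p) xi eta,
    smooth_section_at p xi -> smooth_section_at p eta ->
    cov v (fun q => xi q + eta q) = cov v xi + cov v eta;
  cov_leibniz : forall p (v : tangent N p) (h : N -> R) xi,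
    smooth_real_at p h -> smooth_section_at p xi ->
    cov v (fun q => h q *: xi q) = vder v h *: xi p + h p *: cov v xi;
  cov_local : forall p (v : tangent N p) xi eta,
    smooth_section_at p xi -> (\forall q \near p, xi q = eta q) ->
    cov v xi = cov v eta;
  cov_smooth : forall p (X : forall q, tangent N q) xi,
    smooth_section_at p X -> smooth_section_at p xi ->
    smooth_section_at p (fun q => cov (X q) xi) }.

Definition flat (r : nat) (S : vbundle N r) (D : connection S) : Prop :=
  forall p (X Y : forall q, tangent N q) (z : tangent N p) xi,
    smooth_section_at p X -> smooth_section_at p Y -> smooth_section_at p xi ->
    is_bracket X Y z ->
    D p (X p) (fun q => D q (Y q) xi) - D p (Y p) (fun q => D q (X q) xi)
    = D p z xi.

Definition triv_at (r : nat) (S : vbundle N r) (p : N) :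
    trivialization S r := sval (cid (triv_cover S p)).

(* The extension of [s : S p] to a section with constant components in a local
   trivialization around [p]. *)
Definition ext (r : nat) (S : vbundle N r) (p : N) (s : S p) (q : N) : S q :=
  triv_inv (triv_at S p) q (triv_val (triv_at S p) s).

End Connections.

(* The pull-back connection: if [sigma = \sum_a sigma^a phi^* e_a] in a local
   frame [e], then [D^phi_v sigma] is
   [\sum_a (v(sigma^a) e_a + sigma^a D_(dphi v) e_a)]. *)
Definition pullback_cov (m n : nat) (M : manifold m) (N : manifold n)
    (phi : M -> N) (r : nat) (S : vbundle N r) (D : connection S)
    (x : M) (v : tangent M x) (sigma : forall y, S (phi y)) : S (phi x) :=
  let t := triv_at S (phi x) in
  let e (a : 'I_r) (q : N) : S q := triv_inv t q (delta_mx 0 a) in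
  let c (a : 'I_r) (y : M) : R := triv_val t (sigma y) 0 a in
  \sum_(a < r) (vder v (c a) *: e a (phi x)
                + c a x *: D (phi x) (dmap phi v) (e a)).

Section Metrics.
Variables (n : nat) (N : manifold n).

Record metric := Metric {
  met :> forall p, tangent N p -> tangent N p -> R;
  met_linear : forall p (v : tangent N p), linear (met v : tangent N p -> R^o);
  met_sym : forall p (v w : tangent N p), met v w = met w v;
  met_nondeg : forall p (v : tangent N p), (forall w, met v w = 0) -> v = 0;
  met_smooth : forall p (X Y : forall q, tangent N q),
    smooth_section_at p X -> smooth_section_at p Y ->
    smooth_real_at p (fun q => met (X q) (Y q)) }.

Definition riemannian (g : metric) : Prop :=
  forall p (v : tangent N p), v != 0 -> 0 < g p v v.

Definition levi_civita (g : metric) (nab : connection (tangent N)) : Prop :=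
  (forall p (X Y : forall q, tangent N q),
     smooth_section_at p X -> smooth_section_at p Y ->
     is_bracket X Y (nab p (X p) Y - nab p (Y p) X)) /\
  (forall p (v : tangent N p) (X Y : forall q, tangent N q),
     smooth_section_at p X -> smooth_section_at p Y ->
     vder v (fun q => g q (X q) (Y q))
     = g p (nab p v X) (Y p) + g p (X p) (nab p v Y)).

Definition tbasis (p : N) (i : 'I_n) : tangent N p := delta_mx 0 i : 'rV[R]_n.

(* Components [g^{ij}] of the inverse metric in [tbasis]. *)
Definition ginv (g : metric) (p : N) : 'M[R]_n :=
  invmx (\matrix_(i, j) g p (tbasis p i) (tbasis p j)).

Definition grad (g : metric) (h : N -> R) (p : N) : tangent N p :=
  \sum_(i < n) \sum_(j < n) (ginv g p i j * vder (tbasis p i) h) *: tbasis p j.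

End Metrics.

Definition lorentzian (M : manifold 4) (g : metric M) : Prop :=
  forall x, exists b : 'I_4 -> tangent M x,
    forall i j, g x (b i) (b j) = ((-1) ^+ (i == 0)) *+ (i == j).

Record orientation (n : nat) (M : manifold n) := Orientation {
  ocharts : set (chart M n);
  ocharts_atlas : ocharts `<=` atlas M;
  ocharts_cover : forall x, exists c, ocharts c /\ cdom c x;
  ocharts_pos : forall c d x, ocharts c -> ocharts d -> cdom c x -> cdom d x ->
    0 < \det ('J (d \o cinv c) (c x)) }.

Section FourDim.
Variables (M : manifold 4) (o : orientation M) (g : metric M).

Definition ochart_at (x : M) : chart M 4 := sval (cid (ocharts_cover o x)).

(* The volume form of [(M, g)], evaluated in a positively oriented chart. *)
Definition vol (x : M) (v : 'I_4 -> tangent M x) : R :=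
  let t := tangent_triv (ochart_at x) in
  let d (i : 'I_4) : tangent M x := triv_inv t x (delta_mx 0 i) in
  Num.sqrt `|\det (\matrix_(i < 4, j < 4) g x (d i) (d j))|
  * \det (\matrix_(i < 4) triv_val t (p := x) (v i)).

(* The Hodge dual of [F] is [1/2 F^{ij} vol_{ij..}]; equivalently, the wedge
   product of [rho] with the dual of [F] is [(rho, F)_g vol]. *)
Definition hodge (x : M) (E : lmodType R)
    (F : tangent M x -> tangent M x -> E) (v w : tangent M x) : E :=
  2^-1 *: \sum_(i < 4) \sum_(j < 4) \sum_(k < 4) \sum_(l < 4)
    (ginv g x i k * ginv g x j l
     * vol (tnth [tuple tbasis x k; tbasis x l; v; w]))
    *: F (tbasis x i) (tbasis x j).

(* [1/2 g^{ik} g^{jl} Q(F_ij, H_kl)] *)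
Definition form_pairing (x : M) (E : lmodType R) (Q : E -> E -> R)
    (F H : tangent M x -> tangent M x -> E) : R :=
  2^-1 * \sum_(i < 4) \sum_(j < 4) \sum_(k < 4) \sum_(l < 4)
    ginv g x i k * ginv g x j l
    * Q (F (tbasis x i) (tbasis x j)) (H (tbasis x k) (tbasis x l)).

End FourDim.

Record scalar_structure (n : nat) := ScalarStructure {
  sc_mfd : manifold n;
  sc_met : metric sc_mfd;
  sc_pot : sc_mfd -> R;
  sc_riemannian : riemannian sc_met;
  sc_smooth : forall p, smooth_real_at p sc_pot }.

Record duality_structure (n : nat) (N : manifold n) (r : nat) := Duality {
  du_bundle :> vbundle N r;
  du_conn : connection du_bundle;
  du_symp : forall p, du_bundle p -> du_bundle p -> R;
  du_linear : forall p (s : du_bundle p), linear (du_symp s : du_bundle p -> R^o);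
  du_antisym : forall p (s s' : du_bundle p), du_symp s s' = - du_symp s' s;
  du_nondeg : forall p (s : du_bundle p), (forall s', du_symp s s' = 0) -> s = 0;
  du_smooth : forall p (xi eta : forall q, du_bundle q),
    smooth_section_at p xi -> smooth_section_at p eta ->
    smooth_real_at p (fun q => du_symp (xi q) (eta q));
  du_flat : flat du_conn;
  du_compat : forall p (v : tangent N p) (xi eta : forall q, du_bundle q),
    smooth_section_at p xi -> smooth_section_at p eta ->
    vder v (fun q => du_symp (xi q) (eta q))
    = du_symp (du_conn p v xi) (eta p) + du_symp (xi p) (du_conn p v eta) }.

Record taming (n : nat) (N : manifold n) (r : nat)
    (Delta : duality_structure N r) := Taming {
  tam :> forall p, Delta p -> Delta p;
  tam_linear : forall p, linear (tam (p := p));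
  tam_smooth : forall p (xi : forall q, Delta q), smooth_section_at p xi ->
    smooth_section_at p (fun q => tam (xi q));
  tam_sqr : forall p (s : Delta p), tam (tam s) = - s;
  tam_symp : forall p (s s' : Delta p),
    du_symp (tam s) (tam s') = du_symp s s';
  tam_pos : forall p (s : Delta p), s != 0 -> 0 < du_symp (tam s) s }.

Record em_structure (n : nat) (N : manifold n) (r : nat) := EMStructure {
  em_dual :> duality_structure N r;
  em_J : taming em_dual }.

Record scalar_em_structure (n r : nat) := ScalarEM {
  se_scalar :> scalar_structure n;
  se_em : em_structure (sc_mfd se_scalar) r }.

Section FundamentalField.
Variables (n : nat) (N : manifold n) (r : nat) (Xi : em_structure N r).
Let J := em_J Xi.
Let D := du_conn Xi.

Definition Qform (p : N) (s s' : Xi p) : R := du_symp (J p s) s'.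

(* [Theta_Xi] at [p]: since [D_v o J - J o D_v] is tensorial, it may be computed
   on any extension of [s]. *)
Definition Theta (p : N) (v : tangent N p) (s : Xi p) : Xi p :=
  D p v (fun q => J q (ext s q)) - J p (D p v (ext s)).

(* The component of [Psi = (sharp (x) id)(Theta)] along [tbasis p j]. *)
Definition Psi (G : metric N) (p : N) (j : 'I_n) (s : Xi p) : Xi p :=
  \sum_(i < n) ginv G p i j *: Theta (tbasis p i) s.

End FundamentalField.

Section Solutions.
Variables (M : manifold 4) (o : orientation M) (g : metric M)
  (nabM : connection (tangent M)).
Variables (n r : nat) (DD : scalar_em_structure n r).
Let N : manifold n := sc_mfd DD.
Let Xi : em_structure N r := se_em DD.
Let G : metric N := sc_met DD.
Variable nabN : connection (tangent N).

Definition vtensor (phi : M -> N) : Type :=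
  forall x, tangent M x -> tangent M x -> Xi (phi x).

(* No smoothness, bilinearity or polarity condition is imposed here. *)
Definition field_pair : Type := {phi : M -> N & vtensor phi}.

Definition is_two_form (phi : M -> N) (V : vtensor phi) : Prop :=
  [/\ forall x (v : tangent M x), linear (V x v),
      forall x (v w : tangent M x), V x v w = - V x w v &
      forall x (X Y : forall y, tangent M y),
        smooth_section_at x X -> smooth_section_at x Y ->
        smooth_along_at x (fun y => V y (X y) (Y y))].

Definition is_conf (phi : M -> N) (V : vtensor phi) : Prop :=
  [/\ smooth_map phi, is_two_form V &
      forall x (v w : tangent M x),
        hodge o g (V x) v w = - em_J Xi (phi x) (V x v w)].

Definition Conf : set field_pair := [set z | is_conf (projT2 z)].

(* [(nabla dphi)(v, w)], using any extension of [w] to a local vector field. *)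
Definition second_fundamental (phi : M -> N) (x : M) (v w : tangent M x) :
    tangent N (phi x) :=
  pullback_cov nabN v (fun y => dmap phi (ext w y)) - dmap phi (nabM x v (ext w)).

Definition theta_Sigma (phi : M -> N) (x : M) : tangent N (phi x) :=
  \sum_(i < 4) \sum_(j < 4)
    ginv g x i j *: second_fundamental phi (tbasis x i) (tbasis x j)
  - grad G (sc_pot (s := DD)) (phi x).

(* [( *V, Psi^phi V)], a vector in [T_(phi x) N]. *)
Definition em_source (phi : M -> N) (V : vtensor phi) (x : M) :
    tangent N (phi x) :=
  \sum_(j < n) form_pairing g (@Qform _ _ _ Xi (phi x)) (hodge o g (V x))
                 (fun v w => Psi G j (V x v w)) *: tbasis (phi x) j.

(* [d_(D^phi) V] on [u, v, w]; the extensions [ext u], [ext v], [ext w] are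
   constant in the same chart, so the Lie bracket terms vanish. *)
Definition twisted_d (phi : M -> N) (V : vtensor phi) (x : M)
    (u v w : tangent M x) : Xi (phi x) :=
  pullback_cov (du_conn Xi) u (fun y => V y (ext v y) (ext w y))
  - pullback_cov (du_conn Xi) v (fun y => V y (ext u y) (ext w y))
  + pullback_cov (du_conn Xi) w (fun y => V y (ext u y) (ext v y)).

Definition is_sol (phi : M -> N) (V : vtensor phi) : Prop :=
  (forall x, theta_Sigma phi x - 2^-1 *: em_source V x = 0) /\
  (forall x (u v w : tangent M x), twisted_d V u v w = 0).

Definition Sol : set field_pair := Conf `&` [set z | is_sol (projT2 z)].

End Solutions.

Section TotalSpace.
Variables (n : nat) (N : manifold n) (r : nat) (S : vbundle N r).

Definition total_space : Type := {p : N & S p}.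

Definition total_coord (c : chart N n) (t : trivialization S r) (z : total_space) :
    'rV[R]_(n + r) := row_mx (c (projT1 z)) (triv_val t (projT2 z)).

Definition total_point (c : chart N n) (t : trivialization S r)
    (u : 'rV[R]_(n + r)) : total_space :=
  existT _ (cinv c (lsubmx u)) (triv_inv t (cinv c (lsubmx u)) (rsubmx u)).

Definition total_dom (c : chart N n) (t : trivialization S r) : set total_space :=
  [set z | cdom c (projT1 z) /\ triv_dom t (projT1 z)].

(* Smoothness of a self-map of the total space in bundle charts. It is only
   used for maps covering a continuous map of the base. *)
Definition total_smooth (F : total_space -> total_space) : Prop :=
  forall c t c' t', atlas N c -> trivs S t -> atlas N c' -> trivs S t' ->
    smooth_on (total_coord c t @` (total_dom c t `&` F @^-1` total_dom c' t'))
              (total_coord c' t' \o F \o total_point c t).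

Record unbased_aut := UnbasedAut {
  ub_base : N -> N;
  ub_map :> forall p, S p -> S (ub_base p);
  ub_base_diffeo : diffeomorphism ub_base;
  ub_linear : forall p, linear (ub_map (p := p));
  ub_total : exists F' : total_space -> total_space,
    let F (z : total_space) : total_space :=
      existT _ (ub_base (projT1 z)) (ub_map (projT2 z)) in
    [/\ cancel F F', cancel F' F, total_smooth F & total_smooth F'] }.

End TotalSpace.

Definition isometry (n : nat) (N : manifold n) (G : metric N) (psi : N -> N) : Prop :=
  diffeomorphism psi /\
  forall p (v w : tangent N p),
    G (psi p) (dmap psi v) (dmap psi w) = G p v w.

Definition scalar_aut (n : nat) (Sigma : scalar_structure n)
    (psi : sc_mfd Sigma -> sc_mfd Sigma) : Prop :=
  isometry (sc_met Sigma) psi /\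
  forall p, sc_pot (s := Sigma) (psi p) = sc_pot p.

Section Symmetries.
Variables (n r : nat).

(* [eta] below is the section [f o xi o f_0^-1]. *)
Definition em_aut (N : manifold n) (Xi : em_structure N r)
    (f : unbased_aut Xi) : Prop :=
  [/\ forall p (s s' : Xi p), du_symp (f p s) (f p s') = du_symp s s',
      forall p (s : Xi p), f p (em_J Xi p s) = em_J Xi (ub_base f p) (f p s) &
      forall p (v : tangent N p) (xi eta : forall q, Xi q),
        smooth_section_at p xi ->
        (forall q, eta (ub_base f q) = f q (xi q)) ->
        du_conn Xi (ub_base f p) (dmap (ub_base f) v) eta
        = f p (du_conn Xi p v xi)].

Definition Aut_sem (DD : scalar_em_structure n r) : set (unbased_aut (se_em DD)) :=
  [set f | em_aut f /\ scalar_aut (ub_base f)].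

Definition diamond (M : manifold 4) (DD : scalar_em_structure n r)
    (f : unbased_aut (se_em DD)) (z : field_pair M DD) : field_pair M DD :=
  existT (@vtensor M n r DD)
    (ub_base f \o projT1 z) (fun x v w => f (projT1 z x) (projT2 z x v w)).

End Symmetries.

End Manifolds.

Arguments Aut_sem {R n r} DD _.
Arguments diamond {R n r M DD} f z.

(* Main.v *)
(* The pair (f_0, f) is an isomorphism of all the data entering the equations,
   so each equation for f <> (phi, V) is the image of the one for (phi, V) under
   the injective maps d(f_0) or f.  The connection D is preserved by hypothesis,
   the Levi-Civita connection of the target because f_0 is an isometry, and a
   connection preserved by a bundle map has a pull-back preserved by it; hence
   the tension field and the twisted differential are natural.  Psi is natural
   since Theta is tensorial and musical isomorphisms commute with isometries.
   As f is fibrewise bijective, every pair is f <> of a unique pair, and the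
   equivalence "(phi, V) is a solution iff f <> (phi, V) is" gives both
   inclusions. *)
Require Import Defs.
From HB Require Import structures.
From mathcomp Require Import all_boot all_order all_algebra.
From mathcomp Require Import boolp classical_sets functions.
From mathcomp Require Import reals topology normedtype derive.
From mathcomp Require Import lra.

Set Implicit Arguments.
Unset Strict Implicit.
Unset Printing Implicit Defensive.

Import Order.TTheory GRing.Theory Num.Theory.
Import numFieldNormedType.Exports.

Local Open Scope classical_set_scope.
Local Open Scope ring_scope.

(** * Calculus of smooth maps *)

(** The theorem is coordinate-free but the definitions are not: tangent vectors are components in
    [chart_at p], [pullback_cov] uses [triv_at], [Theta] uses [ext], and [grad] and [Psi] use
    inverse Gram matrices. An automorphism does not respect these choices on the target, so
    naturality cannot be read off the formulas. Each target object first receives a choice-free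
    description: an arbitrary local expansion for [pullback_cov], an arbitrary section for [Theta],
    the duality [G p (sharp alpha) w = alpha w] for the musical isomorphism. Choices made on [M]
    cause no trouble, since both sides use the same ones. Membership in [Conf] must be transported
    too, with the smoothness of [phi] and [V]; backwards this rests on the smooth inverse of the
    total-space map. Proving equivalences for a single [f] avoids showing that its inverse again
    preserves the whole structure. *)

Section ScaleDiff.
Variables (R : realType) (V W : normedModType R).

Lemma scaler_is_bilinear :
  bilinear_for (GRing.Scale.Law.clone _ _ *:%R _) (GRing.Scale.Law.clone _ _ *:%R _)
    (fun (a : R^o) (w : W) => a *: w).
Proof.
split=> [u'|u] a x y /=; first by rewrite scalerDl scalerA.
by rewrite scalerDr !scalerA mulrC.
Qed.

Lemma is_diff_scale (a : V -> R^o) (f : V -> W) (x : V) :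
  differentiable a x -> differentiable f x ->
  differentiable (fun y => a y *: f y) x /\
  forall v, 'd (fun y => a y *: f y) x v = 'd a x v *: f x + a x *: 'd f x v.
Proof.
move=> da df.
(* Scaling is packed as a bilinear map, so that the product rule becomes the differential of a
   bilinear map after a pairing. *)
pose bM := bilinear_isBilinear.Build R R^o W W _ _ _ scaler_is_bilinear.
pose b : {bilinear R^o -> W -> W} := HB.pack (fun (a : R^o) (w : W) => a *: w) bM.
have bc : continuous (fun p : R^o * W => b p.1 p.2).
  by move=> p; exact: (@scale_continuous _ W).
have E : (fun y => a y *: f y) = (fun p => b p.1 p.2) \o (fun y => (a y, f y)) by [].
have dp := differentiable_pair da df.
have db := @differentiable_bilin _ _ _ _ b (a x, f x) bc.
split; first by rewrite E; exact: differentiable_comp.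
move=> v; rewrite E diff_comp //= diff_pair //.
have /= -> := congr1 (fun F : R^o * W -> W => F ('d a x v, 'd f x v))
  (diff_bilin (f := b) (a x, f x) bc).
by rewrite addrC.
Qed.

End ScaleDiff.

Section SmoothOn.
Variables (R : realType).

Section Generic.
Variables (V W : normedModType R).
Implicit Types (U : set V) (f g : V -> W).

Lemma smooth_on_differentiable U f x : smooth_on U f -> U x -> differentiable f x.
Proof. by move=> /(_ 1%N) [+ _]; apply. Qed.

Lemma smooth_on_continuous U f x : smooth_on U f -> U x -> {for x, continuous f}.
Proof. by move=> sf; exact: (sf 0%N x). Qed.

Lemma smooth_on_diff U f v : smooth_on U f -> smooth_on U (fun x => 'd f x v).
Proof. by move=> sf k; have [_ /(_ v)] := sf k.+1. Qed.

(** Every clause of [Ck] is pointwise and concerns a globally defined [f] and its ambient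
    differentials, so shrinking the set, or gluing as in [smooth_on_local], requires no openness.
    Openness enters when [f] is replaced by a function that agrees with it on the set. *)
Lemma smooth_onS U U' f : U' `<=` U -> smooth_on U f -> smooth_on U' f.
Proof.
move=> UU sf k; move: f sf; elim: k => [|k IH] f sf /=.
  by move=> x /UU; exact: smooth_on_continuous.
split=> [x /UU|v]; first exact: smooth_on_differentiable.
by apply: IH; exact: smooth_on_diff.
Qed.

Lemma smooth_on_local U f :
  (forall x, U x -> exists2 U', U' x & smooth_on U' f) -> smooth_on U f.
Proof.
move=> H k; elim: k f H => [|k IH] f H /=.
  by move=> x /H[U' U'x sf]; exact: smooth_on_continuous sf U'x.
split=> [x /H[U' U'x sf]|v]; first exact: smooth_on_differentiable sf U'x.
by apply: IH => x /H[U' U'x sf]; exists U' => //; exact: smooth_on_diff.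
Qed.

Lemma eq_smooth_on U f g : open U -> (forall x, U x -> f x = g x) ->
  smooth_on U f -> smooth_on U g.
Proof. by move=> oU fg sf k; exact: eq_Ck oU fg (sf k). Qed.

Lemma smooth_on_cst U (w : W) : smooth_on U (fun _ => w).
Proof.
move=> k; elim: k w => [|k IH] w /=; first by move=> x _; exact: cst_continuous.
split=> [x _|v]; first exact: (differentiable_cst w x).
rewrite (_ : (fun x => _) = fun=> 0); first exact: IH.
by apply/funext => x; rewrite (diff_cst w x).
Qed.

Lemma Ck_add k U f g : open U -> Ck k U f -> Ck k U g ->
  Ck k U (fun x => f x + g x).
Proof.
move=> oU; elim: k f g => [|k IH] f g /=.
  by move=> cf cg x Ux; exact: (continuousD (cf x Ux) (cg x Ux)).
move=> [df cf] [dg cg]; split=> [x Ux|v].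
  exact: (differentiableD (df x Ux) (dg x Ux)).
apply: eq_Ck oU _ (IH _ _ (cf v) (cg v)) => x Ux.
by have := congr1 (fun F : V -> W => F v) (diffD (df x Ux) (dg x Ux)) => /= <-.
Qed.

Lemma smooth_on_add U f g : open U -> smooth_on U f -> smooth_on U g ->
  smooth_on U (fun x => f x + g x).
Proof. by move=> oU sf sg k; exact: Ck_add. Qed.

Lemma Ck_le k U f : Ck k.+1 U f -> Ck k U f.
Proof.
elim: k f => [|k IH] f [df cf] /=.
  by move=> x Ux; exact: (differentiable_continuous (df x Ux)).
by split=> // v; exact: IH (cf v).
Qed.

End Generic.

Section Algebra.
Variables (V W : normedModType R).
Implicit Types (U : set V) (f g : V -> W).

Lemma Ck_scale k U (a : V -> R^o) f : open U -> Ck k U a ->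
  Ck k U f -> Ck k U (fun x => a x *: f x).
Proof.
move=> oU; elim: k a f => [|k IH] a f.
  move=> ca cf x Ux; exact: (@cvgZ _ W _ _ _ a f (a x) (f x) (ca x Ux) (cf x Ux)).
move=> ca cf; have [da ca'] := ca; have [df cf'] := cf.
have D x Ux := is_diff_scale (da x Ux) (df x Ux).
split=> [x Ux|v]; first exact: (D x Ux).1.
apply: (eq_Ck (f := fun x => 'd a x v *: f x + a x *: 'd f x v)) => //.
  by move=> x Ux; rewrite (D x Ux).2.
(* Each Leibniz term keeps one factor undifferentiated; [Ck_le] lowers it to the order of the
   differentiated one. *)
apply: Ck_add => //; first exact: (IH (fun x => 'd a x v) f (ca' v) (Ck_le cf)).
exact: (IH a (fun x => 'd f x v) (Ck_le ca) (cf' v)).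
Qed.

Lemma smooth_on_scale U (a : V -> R^o) f : open U -> smooth_on U a ->
  smooth_on U f -> smooth_on U (fun x => a x *: f x).
Proof. by move=> oU sa sf k; exact: Ck_scale. Qed.

Lemma smooth_on_linear_comp (W' : normedModType R) U f (L : {linear W -> W'}) :
  open U -> continuous L -> smooth_on U f -> smooth_on U (fun x => L (f x)).
Proof.
move=> oU cL sf k; elim: k f sf => [|k IH] f sf /=.
  move=> x Ux; apply: (@continuous_comp _ _ _ f L); last exact: cL.
  exact: smooth_on_continuous sf Ux.
have dL y := linear_differentiable y cL.
split=> [x Ux|v].
  apply: (@differentiable_comp _ _ _ _ f L) => //.
  exact: smooth_on_differentiable sf Ux.
apply: (eq_Ck (f := fun x => L ('d f x v))) => // [x Ux|].
  have df := smooth_on_differentiable sf Ux.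
  by rewrite (@diff_comp _ _ _ _ f L) //= diff_lin.
exact/IH/smooth_on_diff.
Qed.

End Algebra.

Lemma smooth_on_id (V : normedModType R) (U : set V) : smooth_on U (fun x : V => x).
Proof.
case=> [|k] /=; first by move=> x _; exact: cvg_id.
have did x : is_diff x (id : V -> V) id by exact: is_diff_id.
split=> [x _|v]; first exact: (ex_diff (is_diff_def := did x)).
rewrite (_ : (fun x => _) = fun=> v); first exact: smooth_on_cst.
by apply/funext => x; rewrite (diff_val (is_diff_def := did x)).
Qed.

Lemma row_coordE m (W : lmodType R) (L : {linear 'rV[R]_m -> W}) (v : 'rV[R]_m) :
  L v = \sum_(j < m) v 0 j *: L (delta_mx 0 j).
Proof.
by rewrite {1}[v]row_sum_delta linear_sum; apply: eq_bigr => j _; rewrite linearZ.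
Qed.

Lemma coord_linear_continuous n (j : 'I_n) :
  linear (fun u : 'rV[R]_n => u 0 j : R^o) /\
  continuous (fun u : 'rV[R]_n => u 0 j : R^o).
Proof. by split=> [a u v|]; [rewrite !mxE|exact: coord_continuous]. Qed.

Lemma smooth_on_coord (V : normedModType R) n U (f : V -> 'rV[R]_n) (j : 'I_n) :
  open U -> smooth_on U f -> smooth_on U (fun x => f x 0 j : R^o).
Proof.
move=> oU sf; have [lc cc] := coord_linear_continuous j.
pose lM := GRing.isLinear.Build _ _ _ _ _ lc.
pose L : {linear 'rV[R]_n -> R^o} := HB.pack (fun u : 'rV[R]_n => u 0 j : R^o) lM.
exact: (smooth_on_linear_comp (L := L)) sf.
Qed.

(* [T] need not be open: the chain rule only involves the iterated differentials
   of [g] at points of [T]. *)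
Lemma smooth_on_comp (V : normedModType R) n (W : normedModType R) U T
    (f : V -> 'rV[R]_n) (g : 'rV[R]_n -> W) : open U ->
  (forall x, U x -> T (f x)) ->
  smooth_on U f -> smooth_on T g -> smooth_on U (fun x => g (f x)).
Proof.
move=> oU UT sf sg k; elim: k g sg => [|k IH] g sg /=.
  move=> x Ux; apply: (@continuous_comp _ _ _ f g).
    exact: smooth_on_continuous sf Ux.
  exact: smooth_on_continuous sg (UT _ Ux).
have df x (Ux : U x) := smooth_on_differentiable sf Ux.
have dg x (Ux : U x) := smooth_on_differentiable sg (UT _ Ux).
split=> [x Ux|v].
  by apply: (@differentiable_comp _ _ _ _ f g) => //; [exact: df|exact: dg].
(* Expanding ['d f x v] in the standard basis freezes the direction of ['d g], so the induction
   hypothesis applies to the partial derivatives of [g], again smooth on [T]. Row vectors as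
   intermediate space provide this basis. *)
apply: (eq_Ck (f := fun x =>
    \sum_(j < n) 'd f x v 0 j *: 'd g (f x) (delta_mx 0 j))) => // [x Ux|].
  rewrite (@diff_comp _ _ _ _ f g) //=; [|exact: df|exact: dg].
  by rewrite [RHS]row_coordE.
elim: (index_enum _) => [|j s IHs].
  by under [X in Ck _ _ X]eq_fun do rewrite big_nil; exact: smooth_on_cst.
under [X in Ck _ _ X]eq_fun do rewrite big_cons.
apply: Ck_add => //; apply: Ck_scale => //.
  exact: (smooth_on_coord j oU (smooth_on_diff v sf)).
exact: (IH (fun y => 'd g y (delta_mx 0 j)) (smooth_on_diff _ sg)).
Qed.

End SmoothOn.

Section SmoothNear.
Variables (R : realType) (V W : normedModType R).
Implicit Types (f g : V -> W).

Lemma near_smooth_near x f : smooth_near x f -> \forall y \near x, smooth_near y f.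
Proof.
move=> [U [oU Ux sf]]; apply: filterS (open_nbhs_nbhs (conj oU Ux)) => y Uy.
by exists U.
Qed.

Lemma eq_smooth_near x f g : (\forall y \near x, f y = g y) ->
  smooth_near x f -> smooth_near x g.
Proof.
move=> fg; have : nbhs x [set y | f y = g y] by exact: fg.
rewrite nbhsE => -[A [oA Ax] AE] [U [oU Ux sf]].
have oUA : open (U `&` A) by exact: openI.
exists (U `&` A); split=> //; apply: eq_smooth_on oUA _ (smooth_onS _ sf).
  by move=> y [_ /AE].
exact: subIsetl.
Qed.

Lemma smooth_near_differentiable x f : smooth_near x f -> differentiable f x.
Proof. by move=> [U [_ Ux sf]]; exact: smooth_on_differentiable sf Ux. Qed.

Lemma smooth_near_continuous x f : smooth_near x f -> {for x, continuous f}.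
Proof. by move=> [U [_ Ux sf]]; exact: smooth_on_continuous sf Ux. Qed.

Lemma smooth_near_diff x f v : smooth_near x f -> smooth_near x (fun y => 'd f y v).
Proof. by move=> [U [oU Ux sf]]; exists U; split=> //; exact: smooth_on_diff. Qed.

Lemma smooth_near_cst x (w : W) : smooth_near x (fun _ : V => w).
Proof. by exists setT; split=> //; [exact: openT|exact: smooth_on_cst]. Qed.

Lemma smooth_near_add x f g : smooth_near x f -> smooth_near x g ->
  smooth_near x (fun y => f y + g y).
Proof.
move=> [U [oU Ux sf]] [U' [oU' U'x sg]]; exists (U `&` U').
have oI := openI oU oU'; split=> //; apply: smooth_on_add => //.
  exact: smooth_onS (@subIsetl _ _ _) sf.
exact: smooth_onS (@subIsetr _ _ _) sg.
Qed.

Lemma smooth_near_scale x (a : V -> R^o) f : smooth_near x a -> smooth_near x f ->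
  smooth_near x (fun y => a y *: f y).
Proof.
move=> [U [oU Ux sf]] [U' [oU' U'x sg]]; exists (U `&` U').
have oI := openI oU oU'; split=> //; apply: smooth_on_scale => //.
  exact: smooth_onS (@subIsetl _ _ _) sf.
exact: smooth_onS (@subIsetr _ _ _) sg.
Qed.

Lemma smooth_near_sum (I : Type) (s : seq I) x (F : I -> V -> W) :
  (forall i, smooth_near x (F i)) -> smooth_near x (fun y => \sum_(i <- s) F i y).
Proof.
move=> sF; elim: s => [|i s IH].
  by under [X in smooth_near _ X]eq_fun do rewrite big_nil; exact: smooth_near_cst.
by under [X in smooth_near _ X]eq_fun do rewrite big_cons; exact: smooth_near_add.
Qed.

End SmoothNear.

Section SmoothNearRow.
Variables (R : realType).

Lemma smooth_near_coord (V : normedModType R) n x (f : V -> 'rV[R]_n) (j : 'I_n) :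
  smooth_near x f -> smooth_near x (fun y => f y 0 j : R^o).
Proof. by move=> [U [oU Ux sf]]; exists U; split=> //; exact: smooth_on_coord. Qed.

Lemma smooth_near_row (V : normedModType R) n x (f : V -> 'rV[R]_n) :
  (forall j, smooth_near x (fun y => f y 0 j : R^o)) -> smooth_near x f.
Proof.
move=> sf; apply: (@eq_smooth_near _ _ _ x
    (fun y => \sum_(j < n) (f y 0 j : R^o) *: (delta_mx 0 j : 'rV[R]_n))).
  by apply: filterE => y; rewrite -row_sum_delta.
apply: smooth_near_sum => j; apply: smooth_near_scale => //.
exact: smooth_near_cst.
Qed.

(** Meant for bundle charts, where smoothness is given on an image set that is never shown to be
    open; it suffices that [f] maps a neighbourhood of [x] into it. *)
Lemma smooth_near_comp_on (V : normedModType R) k (W : normedModType R) x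
    (T : set 'rV[R]_k) (f : V -> 'rV[R]_k) (g : 'rV[R]_k -> W) :
  smooth_near x f -> (\forall y \near x, T (f y)) -> smooth_on T g ->
  smooth_near x (g \o f).
Proof.
move=> [U [oU Ux sf]] Tf sg.
have : nbhs x (U `&` f @^-1` T) by apply: filterI => //; exact: open_nbhs_nbhs.
rewrite nbhsE => -[A [oA Ax] AE]; exists A; split=> //.
apply: (smooth_on_comp (T := T)) => // [y /AE[]//|].
by apply: smooth_onS sf => y /AE[].
Qed.

Lemma smooth_near_comp (V : normedModType R) k (W : normedModType R) x
    (f : V -> 'rV[R]_k) (g : 'rV[R]_k -> W) :
  smooth_near x f -> smooth_near (f x) g -> smooth_near x (g \o f).
Proof.
move=> sf [T [oT Tfx sg]]; apply: (smooth_near_comp_on sf _ sg).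
by apply: (smooth_near_continuous sf); exact: open_nbhs_nbhs.
Qed.

Lemma smooth_near_diff_dir (V : normedModType R) n (W : normedModType R) x
    (h : 'rV[R]_n -> W) (f X : V -> 'rV[R]_n) :
  smooth_near (f x) h -> smooth_near x f -> smooth_near x X ->
  smooth_near x (fun y => 'd h (f y) (X y)).
Proof.
move=> sh sf sX.
under [X in smooth_near _ X]eq_fun do rewrite row_coordE.
apply: smooth_near_sum => j; apply: smooth_near_scale.
  exact: smooth_near_coord.
exact: smooth_near_comp sf (smooth_near_diff _ sh).
Qed.

(** The form of the chain rule that fits chart expressions: an inserted [cinv d \o d] cancels only
    near the point, not globally. *)
Lemma diff_comp_near (U V W : normedModType R) (f : U -> V) (g : V -> W)
    (h : U -> W) x v : differentiable f x -> differentiable g (f x) ->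
  (\forall y \near x, g (f y) = h y) -> 'd h x v = 'd g (f x) ('d f x v).
Proof.
move=> df dg E.
have [_ <-] := near_eq_is_diff E (differentiable_comp df dg).
by rewrite diff_comp.
Qed.

End SmoothNearRow.

(** * Manifolds *)

Section Charts.
Variables (R : realType) (n : nat) (N : manifold R n).
Implicit Types (c d : chart R N n) (p : N).

Lemma near_cinv c p (A : set N) : atlas c -> cdom c p -> nbhs p A ->
  \forall u \near c p, A (cinv c u).
Proof.
move=> /atlas_chart[_ _ cK _ cv] cp Ap.
have icp : (c @` cdom c) (c p) by exists p.
have := cv _ icp; rewrite /prop_for /continuous_at (cK _ cp); exact.
Qed.

Lemma near_cmap c p (A : set 'rV[R]_n) : atlas c -> cdom c p -> nbhs (c p) A ->
  \forall q \near p, A (c q).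
Proof. by move=> /atlas_chart[_ _ _ cc _] cp; exact: (cc _ cp). Qed.

Lemma near_cdom c p : atlas c -> cdom c p -> \forall q \near p, cdom c q.
Proof. by move=> /atlas_chart[oc _ _ _ _] cp; exact: open_nbhs_nbhs. Qed.

Lemma near_cinvK c p : atlas c -> cdom c p -> \forall u \near c p, c (cinv c u) = u.
Proof.
move=> /atlas_chart[_ oic cK _ _] cp.
have icp : (c @` cdom c) (c p) by exists p.
apply: filterS (open_nbhs_nbhs (conj oic icp)) => _ [q cq <-].
by rewrite cK.
Qed.

Lemma chartK c p : atlas c -> cdom c p -> cinv c (c p) = p.
Proof. by move=> /atlas_chart[_ _ cK _ _]; exact: cK. Qed.

Lemma transition_smooth c d p : atlas c -> atlas d -> cdom c p -> cdom d p ->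
  smooth_near (c p) (d \o cinv c).
Proof.
move=> ac ad cp dp; exists (c @` (cdom c `&` cdom d)); split.
- exact: open_overlap.
- by exists p.
- exact: atlas_compat.
Qed.

(** Turns the existential chart of [smooth_at] into an arbitrary one, by precomposing with a
    transition map. *)
Lemma smooth_at_chart (W : normedModType R) (h : N -> W) c p : atlas c ->
  cdom c p -> smooth_at p h -> smooth_near (c p) (h \o cinv c).
Proof.
move=> ac cp [d [ad dp sh]].
have sT := transition_smooth ac ad cp dp.
have Ep : (d \o cinv c) (c p) = d p by rewrite /= chartK.
have : smooth_near (c p) ((h \o cinv d) \o (d \o cinv c)).
  by apply: smooth_near_comp => //; rewrite Ep.
apply: eq_smooth_near.
have := near_cinv ac cp (near_cdom ad dp); apply: filterS => u du /=.
by rewrite (chartK ad).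
Qed.

Section SmoothAt.
Variables (W : normedModType R).
Implicit Types (h k : N -> W).

Lemma eq_smooth_at p h k : (\forall q \near p, h q = k q) ->
  smooth_at p h -> smooth_at p k.
Proof.
move=> E [c [ac cp sh]]; exists c; split=> //; apply: eq_smooth_near sh.
exact: (near_cinv ac cp E).
Qed.

Lemma near_smooth_at p h : smooth_at p h -> \forall q \near p, smooth_at q h.
Proof.
move=> [c [ac cp sh]].
apply: filterS2 (near_cmap ac cp (near_smooth_near sh)) (near_cdom ac cp).
by move=> q sq cq; exists c.
Qed.

Lemma smooth_at_cst p (w : W) : smooth_at p (fun _ : N => w).
Proof.
exists (chart_at p); split; [exact: chart_at_atlas|exact: chart_at_dom|].
exact: smooth_near_cst.
Qed.

Lemma smooth_at_add p h k : smooth_at p h -> smooth_at p k ->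
  smooth_at p (fun q => h q + k q).
Proof.
move=> [c [ac cp sh]] /(smooth_at_chart ac cp) sk; exists c; split=> //.
exact: smooth_near_add.
Qed.

Lemma smooth_at_scale p (a : N -> R^o) k : smooth_at p a -> smooth_at p k ->
  smooth_at p (fun q => a q *: k q).
Proof.
move=> [c [ac cp sh]] /(smooth_at_chart ac cp) sk; exists c; split=> //.
exact: smooth_near_scale.
Qed.

Lemma smooth_at_sum (I : Type) (s : seq I) p (F : I -> N -> W) :
  (forall i, smooth_at p (F i)) -> smooth_at p (fun q => \sum_(i <- s) F i q).
Proof.
move=> sF; elim: s => [|i s IH].
  by under [X in smooth_at _ X]eq_fun do rewrite big_nil; exact: smooth_at_cst.
by under [X in smooth_at _ X]eq_fun do rewrite big_cons; exact: smooth_at_add.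
Qed.

End SmoothAt.

Lemma smooth_at_coord k p (h : N -> 'rV[R]_k) (j : 'I_k) :
  smooth_at p h -> smooth_at p (fun q => h q 0 j : R^o).
Proof.
move=> [c [ac cp sh]]; exists c; split=> //; exact: smooth_near_coord sh.
Qed.

Lemma smooth_at_row k p (h : N -> 'rV[R]_k) :
  (forall j, smooth_at p (fun q => h q 0 j : R^o)) -> smooth_at p h.
Proof.
move=> sh; have [c [ac cp]] := atlas_cover p; exists c; split=> //.
by apply: smooth_near_row => j; exact: smooth_at_chart (sh j).
Qed.

Lemma smooth_at_comp_near k (W : normedModType R) p (h : N -> 'rV[R]_k)
    (G : 'rV[R]_k -> W) :
  smooth_at p h -> smooth_near (h p) G -> smooth_at p (G \o h).
Proof.
move=> [c [ac cp sh]] sG; exists c; split=> //.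
apply: (smooth_near_comp (f := h \o cinv c)) => //=.
by rewrite chartK.
Qed.

Lemma chart_image_open c (A : set N) : atlas c -> open A ->
  open (c @` (cdom c `&` A)).
Proof.
move=> ac oA; rewrite openE => _ [p [cp Ap] <-].
have H1 := near_cinv ac cp (open_nbhs_nbhs (conj oA Ap)).
have H2 := near_cinv ac cp (near_cdom ac cp).
have H3 := near_cinvK ac cp.
apply: filterS3 H1 H2 H3 => u uA uc uK.
by exists (cinv c u).
Qed.

End Charts.

Section SmoothMaps.
Variables (R : realType).

Lemma near_preimage (T U : topologicalType) (phi : T -> U) x (A : set U) :
  continuous phi -> nbhs (phi x) A -> \forall q \near x, A (phi q).
Proof. by move=> cphi; exact: (cphi x). Qed.

Lemma smooth_map_near m n (M : manifold R m) (N : manifold R n) (phi : M -> N)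
    (c : chart R M m) (d : chart R N n) x : smooth_map phi -> atlas c -> atlas d ->
  cdom c x -> cdom d (phi x) -> smooth_near (c x) (d \o phi \o cinv c).
Proof.
move=> [cphi sphi] ac ad cx dx.
exists (c @` (cdom c `&` phi @^-1` cdom d)); split; last exact: sphi.
  apply: chart_image_open => //; apply: open_comp => [y _|]; first exact: cphi.
  by have [] := atlas_chart ad.
by exists x.
Qed.

Lemma smooth_mapP m n (M : manifold R m) (N : manifold R n) (phi : M -> N) :
  continuous phi ->
  (forall x, exists c d, [/\ atlas c, atlas d, cdom c x, cdom d (phi x) &
     smooth_near (c x) (d \o phi \o cinv c)]) ->
  smooth_map phi.
Proof.
move=> cphi sphi; split=> // c d ac ad; apply: smooth_on_local => _ [x [cx dx] <-].
suff [U [oU Ux sU]] : smooth_near (c x) (d \o phi \o cinv c) by exists U.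
have [c' [d' [ac' ad' cx' dx' s]]] := sphi x.
have sd : smooth_at x (d' \o phi) by exists c'.
have sd' : smooth_at x ((d \o cinv d') \o (d' \o phi)).
  by apply: smooth_at_comp_near sd _; exact: transition_smooth.
apply: (@smooth_at_chart _ _ _ _ (d \o phi)) => //.
apply: eq_smooth_at sd'.
have := near_preimage cphi (near_cdom ad' dx'); apply: filterS => q dq /=.
by rewrite chartK.
Qed.

Lemma smooth_map_chart m n (M : manifold R m) (N : manifold R n) (phi : M -> N)
    (d : chart R N n) x : smooth_map phi -> atlas d -> cdom d (phi x) ->
  smooth_at x (d \o phi).
Proof.
move=> sphi ad dx; have [c [ac cx]] := atlas_cover x; exists c; split=> //.
exact: smooth_map_near.
Qed.

Lemma smooth_at_comp m n (M : manifold R m) (N : manifold R n) (phi : M -> N)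
    (W : normedModType R) (h : N -> W) x :
  smooth_map phi -> smooth_at (phi x) h -> smooth_at x (h \o phi).
Proof.
move=> sphi [d [ad dx sh]].
have sd := smooth_map_chart sphi ad dx.
have : smooth_at x ((h \o cinv d) \o (d \o phi)) := smooth_at_comp_near sd sh.
apply: eq_smooth_at.
have := near_preimage sphi.1 (near_cdom ad dx); apply: filterS => q dq /=.
by rewrite (chartK ad).
Qed.

Lemma smooth_map_comp m n k (M : manifold R m) (N : manifold R n)
    (P : manifold R k) (phi : M -> N) (psi : N -> P) :
  smooth_map phi -> smooth_map psi -> smooth_map (psi \o phi).
Proof.
move=> sphi spsi; apply: smooth_mapP.
  by move=> x; apply: continuous_comp; [exact: sphi.1|exact: spsi.1].
move=> x; have [c [ac cx]] := atlas_cover x.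
have [d [ad dx]] := atlas_cover (psi (phi x)).
exists c, d; split=> //; apply: (@smooth_at_chart _ _ _ _ (d \o psi \o phi)) => //.
exact: (smooth_at_comp (h := d \o psi) sphi (smooth_map_chart spsi ad dx)).
Qed.

Lemma smooth_map_id n (N : manifold R n) : smooth_map (fun q : N => q).
Proof.
split=> [q|c d]; first exact: cvg_id.
exact: atlas_compat.
Qed.

End SmoothMaps.

(** * Directional derivatives and differentials in arbitrary charts *)

Section ChartDerivatives.
Variables (R : realType).

(** [vder] and [dmap] are written in [chart_at p], which may vary irregularly with [p]. Passing to
    one fixed chart around a point makes their smooth dependence on the point accessible. *)
Lemma diff_chart n (N : manifold R n) (W : normedModType R) (h : N -> W)
    (c d : chart R N n) p w : smooth_at p h -> atlas c -> atlas d ->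
  cdom c p -> cdom d p ->
  'd (h \o cinv c) (c p) w = 'd (h \o cinv d) (d p) (dchange c d p w).
Proof.
move=> sh ac ad cp dp; rewrite /dchange.
have Ep : (d \o cinv c) (c p) = d p by rewrite /= chartK.
rewrite -Ep; apply: diff_comp_near.
- exact/smooth_near_differentiable/transition_smooth.
- by rewrite Ep; exact/smooth_near_differentiable/smooth_at_chart.
- apply: filterS (near_cinv ac cp (near_cdom ad dp)) => u du /=.
  by rewrite (chartK ad).
Qed.

Lemma vder_chart n (N : manifold R n) (c : chart R N n) p (v : tangent N p)
    (h : N -> R) : smooth_real_at p h -> atlas c -> cdom c p ->
  vder v h = 'd ((h : N -> R^o) \o cinv c) (c p) (dchange (chart_at p) c p v).
Proof.
move=> sh ac cp.
exact: (diff_chart v sh (chart_at_atlas p) ac (chart_at_dom p) cp).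
Qed.

Lemma dmap_chart m n (M : manifold R m) (N : manifold R n) (phi : M -> N)
    (c : chart R M m) (d : chart R N n) x (v : tangent M x) :
  smooth_map phi -> atlas c -> atlas d -> cdom c x -> cdom d (phi x) ->
  dchange (chart_at (phi x)) d (phi x) (dmap phi v) =
  'd (d \o phi \o cinv c) (c x) (dchange (chart_at x) c x v).
Proof.
move=> sphi ac ad cx dx.
have ax := chart_at_atlas x; have xx := chart_at_dom x.
have ay := chart_at_atlas (phi x); have yy := chart_at_dom (phi x).
rewrite -(@diff_chart _ _ _ (d \o phi) (chart_at x)) //; last exact: smooth_map_chart.
rewrite /dchange /dmap.
have E : (chart_at (phi x) \o phi \o cinv (chart_at x)) (chart_at x x) =
  chart_at (phi x) (phi x) by rewrite /= chartK.
rewrite -[in LHS]E; apply/esym/diff_comp_near.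
- exact/smooth_near_differentiable/smooth_map_near.
- by rewrite E; exact/smooth_near_differentiable/transition_smooth.
- have := near_cinv ax xx (near_preimage sphi.1 (near_cdom ay yy)).
  by apply: filterS => u du /=; rewrite (chartK ay).
Qed.

Lemma vder_comp m n (M : manifold R m) (N : manifold R n) (phi : M -> N)
    x (v : tangent M x) (h : N -> R) : smooth_map phi -> smooth_real_at (phi x) h ->
  vder v (h \o phi) = vder (dmap phi v) h.
Proof.
move=> sphi sh; rewrite /vder /dmap.
have ax := chart_at_atlas x; have xx := chart_at_dom x.
have ay := chart_at_atlas (phi x); have yy := chart_at_dom (phi x).
have E : (chart_at (phi x) \o phi \o cinv (chart_at x)) (chart_at x x) =
  chart_at (phi x) (phi x) by rewrite /= chartK.
rewrite -[in RHS]E; apply/diff_comp_near.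
- exact/smooth_near_differentiable/smooth_map_near.
- by rewrite E; exact/smooth_near_differentiable/smooth_at_chart.
- have := near_cinv ax xx (near_preimage sphi.1 (near_cdom ay yy)).
  by apply: filterS => u du /=; rewrite (chartK ay).
Qed.

Lemma dmap_comp m n k (M : manifold R m) (N : manifold R n)
    (P : manifold R k) (phi : M -> N) (psi : N -> P) x (v : tangent M x) :
  smooth_map phi -> smooth_map psi ->
  dmap (psi \o phi) v = dmap psi (dmap phi v).
Proof.
move=> sphi spsi; rewrite /dmap /=.
have ax := chart_at_atlas x; have xx := chart_at_dom x.
have ay := chart_at_atlas (phi x); have yy := chart_at_dom (phi x).
have az := chart_at_atlas (psi (phi x)); have zz := chart_at_dom (psi (phi x)).
have E : (chart_at (phi x) \o phi \o cinv (chart_at x)) (chart_at x x) =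
  chart_at (phi x) (phi x) by rewrite /= chartK.
rewrite -[in RHS]E; apply/diff_comp_near.
- exact/smooth_near_differentiable/smooth_map_near.
- by rewrite E; exact/smooth_near_differentiable/smooth_map_near.
- have := near_cinv ax xx (near_preimage sphi.1 (near_cdom ay yy)).
  by apply: filterS => u du /=; rewrite (chartK ay).
Qed.

Lemma dmap_id n (N : manifold R n) (phi : N -> N) p (v : tangent N p) :
  phi =1 id -> dmap phi v = v :> 'rV[R]_n.
Proof.
move=> /funext ->; exact: (dchange_id v (chart_at_atlas p) (chart_at_dom p)).
Qed.

Lemma dmap_linear m n (M : manifold R m) (N : manifold R n) (phi : M -> N) x :
  linear (fun v : tangent M x => dmap phi v).
Proof. by move=> a u v; exact: linearP. Qed.

Section Derivations.
Variables (n : nat) (N : manifold R n).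
Implicit Types (h k : N -> R) (p : N).

Lemma eq_vder p (v : tangent N p) h k : smooth_real_at p h ->
  (\forall q \near p, h q = k q) -> vder v h = vder v k.
Proof.
move=> sh E; rewrite /vder.
have ap := chart_at_atlas p; have pp := chart_at_dom p.
have E' : \forall u \near chart_at p p,
    ((h : N -> R^o) \o cinv (chart_at p)) u = ((k : N -> R^o) \o cinv (chart_at p)) u.
  exact: (near_cinv ap pp E).
have dh := smooth_near_differentiable (smooth_at_chart ap pp sh).
have [_ DE] := near_eq_is_diff E' dh.
exact: (congr1 (fun F : 'rV[R]_n -> R^o => F v) DE).
Qed.

Lemma vder_linear p h : linear (fun v : tangent N p => vder v h : R^o).
Proof. by move=> a u v; rewrite /vder linearP. Qed.

Lemma vder_cst p (v : tangent N p) (a : R) : vder v (fun _ => a) = 0.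
Proof.
exact: (congr1 (fun F : 'rV[R]_n -> R^o => F v) (diff_cst (a : R^o) (chart_at p p))).
Qed.

Lemma vder_add p (v : tangent N p) h k : smooth_real_at p h -> smooth_real_at p k ->
  vder v (fun q => h q + k q) = vder v h + vder v k.
Proof.
move=> sh sk; have ap := chart_at_atlas p; have pp := chart_at_dom p.
exact: (congr1 (fun F : 'rV[R]_n -> R^o => F v)
  (diffD (smooth_near_differentiable (smooth_at_chart ap pp sh))
         (smooth_near_differentiable (smooth_at_chart ap pp sk)))).
Qed.

Lemma vder_sum (I : Type) (s : seq I) p (v : tangent N p) (h : I -> N -> R) :
  (forall i, smooth_real_at p (h i)) ->
  vder v (fun q => \sum_(i <- s) h i q) = \sum_(i <- s) vder v (h i).
Proof.
move=> sh; elim: s => [|i s IH].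
  by under eq_fun do rewrite big_nil; rewrite big_nil vder_cst.
under eq_fun do rewrite big_cons; rewrite big_cons vder_add ?IH //.
exact: (@smooth_at_sum _ _ _ R^o).
Qed.

Lemma vder_mul p (v : tangent N p) h k : smooth_real_at p h -> smooth_real_at p k ->
  vder v (fun q => h q * k q) = vder v h * k p + h p * vder v k.
Proof.
move=> sh sk; have ap := chart_at_atlas p; have pp := chart_at_dom p.
have [_ /(_ v)] := is_diff_scale (smooth_near_differentiable (smooth_at_chart ap pp sh))
   (smooth_near_differentiable (smooth_at_chart ap pp sk)).
by rewrite /= chartK.
Qed.

End Derivations.

End ChartDerivatives.

(** * Bundles and connections *)

Section LinearPred.
Variables (R : realType) (U V : lmodType R) (f : U -> V).
Hypothesis lf : linear f.

Lemma linear_predD u v : f (u + v) = f u + f v.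
Proof. by have := lf 1 u v; rewrite !scale1r. Qed.

Lemma linear_pred0 : f 0 = 0.
Proof. by apply: (addrI (f 0)); rewrite -linear_predD !addr0. Qed.

Lemma linear_predZ a u : f (a *: u) = a *: f u.
Proof. by have := lf a u 0; rewrite linear_pred0 !addr0. Qed.

Lemma linear_predN u : f (- u) = - f u.
Proof. by rewrite -scaleN1r linear_predZ scaleN1r. Qed.

Lemma linear_predB u v : f (u - v) = f u - f v.
Proof. by rewrite linear_predD linear_predN. Qed.

Lemma linear_pred_sum (I : Type) (s : seq I) (F : I -> U) :
  f (\sum_(i <- s) F i) = \sum_(i <- s) f (F i).
Proof.
elim: s => [|i s IH]; first by rewrite !big_nil linear_pred0.
by rewrite !big_cons linear_predD IH.
Qed.

End LinearPred.

Section Bundles.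
Variables (R : realType) (n : nat) (N : manifold R n) (r : nat) (S : vbundle N r).
Implicit Types (t : trivialization S r) (p q : N).

Definition frame t (a : 'I_r) q : S q := triv_inv t q (delta_mx 0 a).

Lemma frame_expand t q (s : S q) : trivs t -> triv_dom t q ->
  s = \sum_(a < r) triv_val t s 0 a *: frame t a q.
Proof.
move=> tS tq; apply: (can_inj (triv_valK tS tq)).
rewrite (linear_pred_sum (triv_linear tS tq)) [LHS]row_sum_delta.
apply: eq_bigr => a _.
by rewrite (linear_predZ (triv_linear tS tq)) triv_invK.
Qed.

Lemma near_triv_dom t q : trivs t -> triv_dom t q -> \forall q' \near q, triv_dom t q'.
Proof. by move=> tS tq; apply: open_nbhs_nbhs; split=> //; exact: triv_open. Qed.

Lemma triv_at_trivs p : trivs (triv_at S p).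
Proof. exact: (svalP (cid (triv_cover S p))).1. Qed.

Lemma triv_at_dom p : triv_dom (triv_at S p) p.
Proof. exact: (svalP (cid (triv_cover S p))).2. Qed.

End Bundles.

Section SmoothAlong.
Variables (R : realType) (m n : nat) (M : manifold R m) (N : manifold R n).
Variables (phi : M -> N) (sphi : smooth_map phi) (r : nat) (S : vbundle N r).
Implicit Types (t : trivialization S r) (sigma tau : forall y, S (phi y)).

(** Expanding in the frame of the given trivialization leaves the transition functions, smooth on
    [N] by [triv_compat] and then composed with [phi]. So smoothness along [phi] may be tested in
    any trivialization. *)
Lemma smooth_along_triv t x sigma : smooth_along_at x sigma -> trivs t ->
  triv_dom t (phi x) -> smooth_at x (fun y => triv_val t (sigma y)).
Proof.
move=> [s [sS sx ss]] tS tx.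
apply: (@eq_smooth_at _ _ _ _ _ (fun y => \sum_(a < r)
   (triv_val s (sigma y) 0 a : R^o) *: triv_val t (triv_inv s (phi y) (delta_mx 0 a)))).
  have H1 := near_preimage sphi.1 (near_triv_dom sS sx).
  have H2 := near_preimage sphi.1 (near_triv_dom tS tx).
  apply: filterS2 H1 H2 => y sy ty.
  rewrite [in RHS](frame_expand (sigma y) sS sy) (linear_pred_sum (triv_linear tS ty)).
  by apply: eq_bigr => a _; rewrite (linear_predZ (triv_linear tS ty)).
apply: smooth_at_sum => a; apply: smooth_at_scale; first exact: smooth_at_coord ss.
exact: (smooth_at_comp sphi (triv_compat (delta_mx 0 a) sS tS sx tx)).
Qed.

Lemma eq_smooth_along x sigma tau : (\forall y \near x, sigma y = tau y) ->
  smooth_along_at x sigma -> smooth_along_at x tau.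
Proof.
move=> E [t [tS tx st]]; exists t; split=> //; apply: eq_smooth_at st.
by apply: filterS E => y ->.
Qed.

Lemma smooth_along_coord x sigma (a : 'I_r) : smooth_along_at x sigma ->
  smooth_real_at x (fun y => triv_val (triv_at S (phi x)) (sigma y) 0 a).
Proof.
move=> ss; apply: smooth_at_coord.
apply: smooth_along_triv ss _ _; [exact: triv_at_trivs|exact: triv_at_dom].
Qed.

Lemma smooth_along_add x sigma tau : smooth_along_at x sigma ->
  smooth_along_at x tau -> smooth_along_at x (fun y => sigma y + tau y).
Proof.
move=> [t [tS tx ss]] /smooth_along_triv - /(_ t tS tx) st.
exists t; split=> //; apply: eq_smooth_at (smooth_at_add ss st).
apply: filterS (near_preimage sphi.1 (near_triv_dom tS tx)) => y ty.
by rewrite (linear_predD (triv_linear tS ty)).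
Qed.

Lemma smooth_along_scale x (c : M -> R) sigma : smooth_real_at x c ->
  smooth_along_at x sigma -> smooth_along_at x (fun y => c y *: sigma y).
Proof.
move=> sc [t [tS tx ss]]; exists t; split=> //.
apply: eq_smooth_at (smooth_at_scale sc ss).
apply: filterS (near_preimage sphi.1 (near_triv_dom tS tx)) => y ty.
by rewrite (linear_predZ (triv_linear tS ty)).
Qed.

Lemma smooth_along0 x : smooth_along_at x (fun y => 0 : S (phi y)).
Proof.
have [t [tS tx]] := triv_cover S (phi x); exists t; split=> //.
apply: eq_smooth_at (smooth_at_cst x 0).
apply: filterS (near_preimage sphi.1 (near_triv_dom tS tx)) => y ty.
by rewrite (linear_pred0 (triv_linear tS ty)).
Qed.

Lemma smooth_along_sum (I : Type) (s : seq I) x (F : I -> forall y, S (phi y)) :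
  (forall i, smooth_along_at x (F i)) ->
  smooth_along_at x (fun y => \sum_(i <- s) F i y).
Proof.
move=> sF; elim: s => [|i s IH].
  by apply: eq_smooth_along (smooth_along0 x); apply: filterE => y; rewrite big_nil.
apply: eq_smooth_along (smooth_along_add (sF i) IH).
by apply: filterE => y; rewrite big_cons.
Qed.

End SmoothAlong.

Section Sections.
Variables (R : realType) (n : nat) (N : manifold R n) (r : nat) (S : vbundle N r).

Lemma smooth_frame (t : trivialization S r) (a : 'I_r) p : trivs t -> triv_dom t p ->
  smooth_section_at p (frame t a).
Proof.
move=> tS tp; exists t; split=> //.
apply: eq_smooth_at (smooth_at_cst p (delta_mx 0 a)).
by apply: filterS (near_triv_dom tS tp) => q tq; rewrite triv_invK.
Qed.

Lemma smooth_frame_at p (a : 'I_r) : smooth_section_at p (frame (triv_at S p) a).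
Proof. exact/smooth_frame/triv_at_dom/triv_at_trivs. Qed.

Lemma smooth_ext p (s : S p) : smooth_section_at p (ext s).
Proof.
have tS := triv_at_trivs S p; have tp := triv_at_dom S p.
exists (triv_at S p); split=> //.
apply: eq_smooth_at (smooth_at_cst p (triv_val (triv_at S p) s)).
by apply: filterS (near_triv_dom tS tp) => q tq; rewrite triv_invK.
Qed.

Lemma ext_at p (s : S p) : ext s p = s.
Proof. by rewrite /ext triv_valK //; [exact: triv_at_trivs|exact: triv_at_dom]. Qed.

(** By conversion, a section is a section along the identity map, so the results for pull-back
    bundles specialize. *)
Lemma smooth_section_scale p (c : N -> R) (xi : forall q, S q) : smooth_real_at p c ->
  smooth_section_at p xi -> smooth_section_at p (fun q => c q *: xi q).
Proof. exact: (smooth_along_scale (smooth_map_id N)). Qed.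

Lemma smooth_section_sum (I : Type) (s : seq I) p (F : I -> forall q, S q) :
  (forall i, smooth_section_at p (F i)) ->
  smooth_section_at p (fun q => \sum_(i <- s) F i q).
Proof. exact: (smooth_along_sum (smooth_map_id N)). Qed.

Lemma smooth_section_coord p (xi : forall q, S q) (a : 'I_r) :
  smooth_section_at p xi ->
  smooth_real_at p (fun q => triv_val (triv_at S p) (xi q) 0 a).
Proof. exact: (smooth_along_coord (smooth_map_id N)). Qed.

Lemma near_frame_expand p (xi : forall q, S q) :
  \forall q \near p, xi q =
    \sum_(a < r) triv_val (triv_at S p) (xi q) 0 a *: frame (triv_at S p) a q.
Proof.
have tS := triv_at_trivs S p; have tp := triv_at_dom S p.
by apply: filterS (near_triv_dom tS tp) => q tq; exact: frame_expand.
Qed.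

End Sections.

Section Connections.
Variables (R : realType) (n : nat) (N : manifold R n) (r : nat) (S : vbundle N r).
Variable (D : connection S).

Lemma cov_sum (I : Type) (s : seq I) p (v : tangent N p) (F : I -> forall q, S q) :
  (forall i, smooth_section_at p (F i)) ->
  D p v (fun q => \sum_(i <- s) F i q) = \sum_(i <- s) D p v (F i).
Proof.
move=> sF; elim: s => [|i s IH].
  (* The connection axioms do not mention the zero section; additivity applied to [z + z = z] makes
     its derivative vanish. *)
  rewrite big_nil; set z := (fun q => _).
  have sz : smooth_section_at p z by exact: smooth_section_sum.
  have zz : (fun q => z q + z q) = z.
    by apply: functional_extensionality_dep => q; rewrite /z big_nil addr0.
  by apply: (addrI (D p v z)); rewrite addr0 -(cov_add D v sz sz) zz.
rewrite big_cons -IH -(cov_add D v (sF i)); last exact: smooth_section_sum.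
by congr (D p v _); apply: functional_extensionality_dep => q; rewrite big_cons.
Qed.

Lemma cov_comb (I : Type) (s : seq I) p (v : tangent N p) (c : I -> N -> R)
    (e : I -> forall q, S q) (xi : forall q, S q) :
  (forall i, smooth_real_at p (c i)) -> (forall i, smooth_section_at p (e i)) ->
  (\forall q \near p, xi q = \sum_(i <- s) c i q *: e i q) ->
  D p v xi = \sum_(i <- s) (vder v (c i) *: e i p + c i p *: D p v (e i)).
Proof.
move=> sc se E.
have sF i : smooth_section_at p (fun q => c i q *: e i q) by exact: smooth_section_scale.
rewrite -(cov_local D v (xi := fun q => \sum_(i <- s) c i q *: e i q)).
- by rewrite cov_sum //; apply: eq_bigr => i _; rewrite (cov_leibniz D).
- exact: smooth_section_sum.
- by apply: filterS E => q ->.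
Qed.

End Connections.

(** * Pull-back connections and their behaviour under bundle maps *)

Section PullbackConnection.
Variables (R : realType) (m n : nat) (M : manifold R m) (N : manifold R n).
Variables (phi : M -> N) (sphi : smooth_map phi) (r : nat) (S : vbundle N r).
Variable (D : connection S).

(* [pullback_cov] is computed in the frame of one fixed trivialization; any local
   expansion in pulled-back sections gives the same value. *)
Lemma pullback_cov_comb (I : Type) (s : seq I) x (v : tangent M x) (c : I -> M -> R)
    (e : I -> forall q, S q) (sigma : forall y, S (phi y)) :
  (forall i, smooth_real_at x (c i)) -> (forall i, smooth_section_at (phi x) (e i)) ->
  (\forall y \near x, sigma y = \sum_(i <- s) c i y *: e i (phi y)) ->
  pullback_cov D v sigma =
  \sum_(i <- s) (vder v (c i) *: e i (phi x) + c i x *: D (phi x) (dmap phi v) (e i)).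
Proof.
move=> sc se E; rewrite /pullback_cov.
set t := triv_at S (phi x).
have tS : trivs t := triv_at_trivs S _; have tx : triv_dom t (phi x) := triv_at_dom S _.
pose E_ i b q : R := triv_val t (e i q) 0 b.
have sE i b : smooth_real_at (phi x) (E_ i b) by exact: smooth_section_coord.
have sEphi i b : smooth_real_at x (E_ i b \o phi).
  exact: (@smooth_at_comp _ _ _ _ _ _ R^o (E_ i b) _ sphi (sE i b)).
have near_t := near_preimage sphi.1 (near_triv_dom tS tx).
have comp b : \forall y \near x,
    \sum_(i <- s) c i y * E_ i b (phi y) = triv_val t (sigma y) 0 b.
  apply: filterS2 E near_t => y -> ty.
  rewrite (linear_pred_sum (triv_linear tS ty)) summxE; apply: eq_bigr => i _.
  by rewrite (linear_predZ (triv_linear tS ty)) mxE.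
have sprod i b : smooth_real_at x (fun y => c i y * E_ i b (phi y)).
  exact: (smooth_at_scale (sc i) (sEphi i b)).
have dcomp b : vder v (fun y => triv_val t (sigma y) 0 b) =
    \sum_(i <- s) (vder v (c i) * E_ i b (phi x)
                   + c i x * vder (dmap phi v) (E_ i b)).
  rewrite -(eq_vder v _ (comp b)); last first.
    by apply: (@smooth_at_sum _ _ _ R^o) => i; exact: sprod.
  rewrite vder_sum //; apply: eq_bigr => i _.
  by rewrite (vder_mul v (sc i) (sEphi i b)) -(vder_comp v sphi (sE i b)).
under eq_bigr => b _.
  rewrite dcomp -(nbhs_singleton (comp b)) scaler_suml scaler_suml -big_split /=.
  over.
(* For fixed [i] the sum over [b] has three kinds of terms. Those with [vder v (c i)] reassemble
   [e i (phi x)]; those with [vder (dmap phi v) (E_ i b)] and with the derivative of the frame are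
   the Leibniz expansion of the derivative of [e i]. *)
rewrite exchange_big /=; apply: eq_bigr => i _.
rewrite [in RHS](cov_comb D (s := index_enum _) (dmap phi v) (sE i)
  (fun b => smooth_frame b tS tx)); last exact: near_frame_expand.
rewrite (frame_expand (e i (phi x)) tS tx) !scaler_sumr -big_split /=.
apply: eq_bigr => b _; rewrite /frame /E_.
by rewrite scalerDl !scalerDr !scalerA addrA.
Qed.

End PullbackConnection.

Section Intertwining.
Variables (R : realType) (n n' : nat) (N : manifold R n) (N' : manifold R n').
Variables (r r' : nat) (S : vbundle N r) (S' : vbundle N' r').
Variables (D : connection S) (D' : connection S').
Variables (psi : N -> N') (f : forall p, S p -> S' (psi p)).

(** One related section [eta] per [xi] is enough for pull-backs. Bundling its existence and
    smoothness treats a bundle automorphism and the differential of an isometry alike, and hides the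
    transport between fibers. *)
Definition intertwines : Prop :=
  forall p (xi : forall q, S q), smooth_section_at p xi ->
  exists eta : forall q, S' q, [/\ smooth_section_at (psi p) eta,
    forall q, eta (psi q) = f (xi q) &
    forall v : tangent N p, D' (psi p) (dmap psi v) eta = f (D p v xi)].

(** The images of the frame at [phi x] need not form the frame that [triv_at] selects at
    [psi (phi x)]. By [pullback_cov_comb] they may still be used on the left, with the coefficients
    of [sigma] unchanged, and [f] then factors out term by term. *)
Lemma pullback_cov_natural m (M : manifold R m) (phi : M -> N) x (v : tangent M x)
    (sigma : forall y, S (phi y)) :
  (forall p, linear (f (p := p))) -> intertwines ->
  smooth_map phi -> smooth_map psi -> smooth_along_at x sigma ->
  pullback_cov (phi := psi \o phi) D' v (fun y => f (sigma y)) =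
  f (pullback_cov D v sigma).
Proof.
move=> lf fD sphi spsi ss.
set t := triv_at S (phi x).
have tS : trivs t := triv_at_trivs S _; have tx : triv_dom t (phi x) := triv_at_dom S _.
have /choice[eta eta_spec] : forall a, exists eta : forall q, S' q,
  [/\ smooth_section_at (psi (phi x)) eta,
    forall q, eta (psi q) = f (frame t a q) &
    forall v : tangent N (phi x), D' (psi (phi x)) (dmap psi v) eta
       = f (D (phi x) v (frame t a))].
  by move=> a; apply: fD; exact: smooth_frame.
rewrite (@pullback_cov_comb _ _ _ _ _ _ (smooth_map_comp sphi spsi) _ _ D' _
  (index_enum _) x v (fun a y => triv_val t (sigma y) 0 a) eta).
- rewrite /pullback_cov (linear_pred_sum (lf _)); apply: eq_bigr => a _.
  have [_ eE etaD] := eta_spec a.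
  by rewrite dmap_comp // etaD eE (linear_predD (lf _)) !(linear_predZ (lf _)).
- by move=> a; exact: smooth_along_coord.
- by move=> a; have [] := eta_spec a.
- apply: filterS (near_preimage sphi.1 (near_triv_dom tS tx)) => y ty.
  rewrite {1}(frame_expand (sigma y) tS ty) (linear_pred_sum (lf _)).
  apply: eq_bigr => a _; have [_ -> _] := eta_spec a.
  by rewrite (linear_predZ (lf _)).
Qed.

Lemma push_section (chi : N' -> N) (xi : forall q, S q) :
  cancel psi chi -> cancel chi psi -> smooth_map chi ->
  exists eta : forall q, S' q, (forall q, eta (psi q) = f (xi q)) /\
    (forall p, smooth_along_at p (fun q => f (xi q)) -> smooth_section_at (psi p) eta).
Proof.
move=> psiK chiK schi.
(* The value lies over [psi (chi q)], which equals [q] only propositionally, hence the transport. At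
   a point [psi q] it is along a proof of a reflexive equality and disappears. *)
pose eta q : S' q := eq_rect _ (fun q' => S' q' : Type) (f (xi (chi q))) _ (chiK q).
have etaE q : eta (psi q) = f (xi q).
  rewrite /eta; move: (chiK (psi q)); rewrite psiK => e.
  by rewrite (eq_irrelevance e erefl).
exists eta; split=> // p [t [tS tp st]]; exists t; split=> //.
have : smooth_at (psi p) ((fun q => triv_val t (f (xi q))) \o chi).
  by apply: smooth_at_comp schi _; rewrite psiK.
by apply: eq_smooth_at; apply: filterE => q /=; rewrite -etaE chiK.
Qed.

End Intertwining.

(** * Naturality of the Levi-Civita connection *)

Section TangentBundle.
Variables (R : realType).

Lemma smooth_vfieldP n (N : manifold R n) (c : chart R N n) p (X : forall q, tangent N q) :
  atlas c -> cdom c p -> smooth_section_at p X ->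
  smooth_at p (fun q => dchange (chart_at q) c q (X q)).
Proof.
move=> ac cp sX.
have tT : trivs (v := tangent N) (tangent_triv c) by exists c.
exact: (smooth_along_triv (smooth_map_id N) sX tT cp).
Qed.

(** Common source of the smoothness of [vder (X q) h] and of [dmap phi (X y)]: in one fixed chart
    both have this form, for a real function and for [d \o phi] respectively. *)
Lemma diff_dir_smooth n (N : manifold R n) (W : normedModType R) (h : N -> W)
    (c : chart R N n) p (X : forall q, tangent N q) : atlas c -> cdom c p ->
  smooth_at p h -> smooth_section_at p X ->
  smooth_at p (fun q => 'd (h \o cinv c) (c q) (dchange (chart_at q) c q (X q))).
Proof.
move=> ac cp sh sX; have := smooth_vfieldP ac cp sX.
move=> /(smooth_at_chart ac cp) sX'; exists c; split=> //.
apply: (@eq_smooth_near _ _ _ _ (fun u => 'd (h \o cinv c) u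
    (dchange (chart_at (cinv c u)) c (cinv c u) (X (cinv c u))))).
  by apply: filterS (near_cinvK ac cp) => u /= ->.
have sc := smooth_at_chart ac cp sh.
apply: (smooth_near_diff_dir (f := fun u => u) sc _ sX').
by exists setT; split=> //; [exact: openT|exact: smooth_on_id].
Qed.

Lemma vder_smooth n (N : manifold R n) (h : N -> R) p (X : forall q, tangent N q) :
  smooth_real_at p h -> smooth_section_at p X ->
  smooth_real_at p (fun q => vder (X q) h).
Proof.
move=> sh sX; have [c [ac cp]] := atlas_cover p.
apply: eq_smooth_at (diff_dir_smooth ac cp sh sX).
apply: filterS2 (near_smooth_at sh) (near_cdom ac cp) => q shq cq.
by rewrite (vder_chart (c := c)).
Qed.

Lemma dmap_smooth m n (M : manifold R m) (N : manifold R n) (phi : M -> N) x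
    (X : forall q, tangent M q) : smooth_map phi -> smooth_section_at x X ->
  smooth_along_at (phi := phi) (S := tangent N) x (fun y => dmap phi (X y)).
Proof.
move=> sphi sX; have [c [ac cx]] := atlas_cover x.
have [d [ad dx]] := atlas_cover (phi x).
exists (tangent_triv d); split; [by exists d|by []|] => /=.
apply: eq_smooth_at (diff_dir_smooth ac cx (smooth_map_chart sphi ad dx) sX).
have H := near_preimage sphi.1 (near_cdom ad dx).
apply: filterS2 (near_cdom ac cx) H => y cy dy.
by rewrite (dmap_chart (c := c)).
Qed.

Section Brackets.
Variables (n : nat) (N : manifold R n).
Implicit Types (X Y : forall q, tangent N q) (p : N).

Lemma vder_coord p (z : tangent N p) (j : 'I_n) :
  vder z (fun q => chart_at p q 0 j) = z 0 j.
Proof.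
have ap := chart_at_atlas p; have pp := chart_at_dom p.
have [lc cc] := coord_linear_continuous R j.
pose lM := GRing.isLinear.Build _ _ _ _ _ lc.
pose L : {linear 'rV[R]_n -> R^o} := HB.pack (fun u : 'rV[R]_n => u 0 j : R^o) lM.
have E : \forall u \near chart_at p p,
    L u = ((fun q => chart_at p q 0 j : R^o) \o cinv (chart_at p)) u.
  by apply: filterS (near_cinvK ap pp) => u /= ->.
have [_ DE] := near_eq_is_diff E (linear_differentiable (f := L) _ cc).
rewrite /vder -DE; exact: (congr1 (fun F : 'rV[R]_n -> R^o => F z) (diff_lin (f := L) _ cc)).
Qed.

(** [is_bracket] only fixes the action on functions, but the coordinates of [chart_at p] already
    separate tangent vectors, by [vder_coord]. *)
Lemma is_bracket_unique X Y p (z z' : tangent N p) :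
  is_bracket X Y z -> is_bracket X Y z' -> z = z'.
Proof.
move=> bz bz'; have ap := chart_at_atlas p; have pp := chart_at_dom p.
have sc j : smooth_real_at p (fun q => chart_at p q 0 j).
  apply: smooth_at_coord; exists (chart_at p); split=> //.
  exact: (transition_smooth ap ap pp pp).
by apply/rowP => j; rewrite -!vder_coord (bz _ (sc j)) (bz' _ (sc j)).
Qed.

End Brackets.

(** For [psi]-related fields, differentiating [h] along [A'] and then composing with [psi] is
    differentiating [h \o psi] along [A]. A second chain rule gives [key], which is used once for
    each term of the bracket. *)
Lemma is_bracket_push n n' (N : manifold R n) (N' : manifold R n') (psi : N -> N')
    (X Y : forall q, tangent N q) (X' Y' : forall q, tangent N' q) p (z : tangent N p) :
  smooth_map psi ->
  (forall q, X' (psi q) = dmap psi (X q)) -> (forall q, Y' (psi q) = dmap psi (Y q)) ->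
  smooth_section_at p X -> smooth_section_at p Y ->
  smooth_section_at (psi p) X' -> smooth_section_at (psi p) Y' ->
  is_bracket X Y z -> is_bracket X' Y' (dmap psi z).
Proof.
move=> spsi EX EY sX sY sX' sY' bz h sh.
have shpsi : smooth_real_at p (h \o psi).
  exact: (@smooth_at_comp _ _ _ _ _ _ R^o h _ spsi sh).
have key (A : forall q, tangent N q) (A' : forall q, tangent N' q) (v : tangent N p) :
    (forall q, A' (psi q) = dmap psi (A q)) ->
    smooth_section_at p A -> smooth_section_at (psi p) A' ->
    vder v (fun q => vder (A q) (h \o psi)) =
    vder (dmap psi v) (fun q => vder (A' q) h).
  move=> EA sA sA'.
  rewrite -(vder_comp v spsi (vder_smooth sh sA')).
  apply: eq_vder; first exact: vder_smooth.
  apply: filterS (near_preimage spsi.1 (near_smooth_at sh)) => q shq /=.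
  by rewrite EA (vder_comp _ spsi).
by rewrite -(vder_comp z spsi sh) (bz _ shpsi) EX EY (key _ _ _ EX) // (key _ _ _ EY).
Qed.

End TangentBundle.

Section Metrics.
Variables (R : realType) (n : nat) (N : manifold R n) (G : metric N).

Lemma met_linear_l p (w : tangent N p) : linear (fun v : tangent N p => G p v w : R^o).
Proof.
move=> a u v; rewrite met_sym (linear_predD (met_linear _ _)).
by rewrite (linear_predZ (met_linear _ _)) !(met_sym _ w).
Qed.

Lemma met_inj p (v w : tangent N p) : (forall z, G p v z = G p w z) -> v = w.
Proof.
move=> E; apply/eqP; rewrite -subr_eq0; apply/eqP/(@met_nondeg _ _ _ G) => z.
by rewrite (linear_predB (met_linear_l z)) E subrr.
Qed.

End Metrics.

Section Isometries.
Variables (R : realType) (n : nat) (N : manifold R n) (G : metric N).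
Variables (psi : N -> N) (isom : Defs.isometry G psi).

Lemma isometry_smooth : smooth_map psi.
Proof. by have [[]] := isom. Qed.

Lemma diffeo_dmap_surj p (w : tangent N (psi p)) :
  exists v : tangent N p, dmap psi v = w.
Proof.
have [[spsi [chi [psiK chiK schi]]] _] := isom.
(* The candidate [dmap chi w] lives over [chi (psi p)], not over [p]. As all tangent fibers are the
   same row space, it can be read over [p], and [Eq] compares the two differentials. *)
have Eq q (v : 'rV[R]_n) : q = p ->
  dmap psi (v : tangent N q) = dmap psi (v : tangent N p) :> 'rV[R]_n by move=> ->.
exists (dmap chi w : 'rV[R]_n).
rewrite -(Eq (chi (psi p))) // -dmap_comp //.
exact: dmap_id.
Qed.

Lemma diffeo_dmap_inj p : injective (fun v : tangent N p => dmap psi v).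
Proof.
move=> v w /= vw; have [_ Gpsi] := isom; apply: (@met_inj _ _ _ G) => z.
by rewrite -Gpsi vw Gpsi.
Qed.

Lemma isometry_push (X : forall q, tangent N q) :
  exists X' : forall q, tangent N q, (forall q, X' (psi q) = dmap psi (X q)) /\
    (forall p, smooth_section_at p X -> smooth_section_at (psi p) X').
Proof.
have [[spsi [chi [psiK chiK schi]]] _] := isom.
have [X' [EX sX]] := push_section (S := tangent N) (S' := tangent N)
  (fun p v => dmap psi v) X psiK chiK schi.
by exists X'; split=> // p sp; apply: sX; exact: dmap_smooth.
Qed.

(* The difference [b] of the transported connection and the original one, lowered
   with [G], is symmetric in its first two arguments (no torsion) and skew in its
   last two (metricity), hence vanishes. *)
Lemma levi_civita_natural (nab : connection (tangent N)) : levi_civita G nab ->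
  intertwines nab nab (fun p (v : tangent N p) => dmap psi v).
Proof.
move=> [torsion compat] p X sX.
have spsi := isometry_smooth; have [_ Gpsi] := isom.
have [X' [EX sX']] := isometry_push X.
exists X'; split=> //; first exact: sX'.
pose related (A A' : forall q, tangent N q) :=
  [/\ forall q, A' (psi q) = dmap psi (A q), smooth_section_at p A
    & smooth_section_at (psi p) A'].
pose b (A B C A' B' C' : forall q, tangent N q) : R :=
  G (psi p) (nab (psi p) (A' (psi p)) B') (C' (psi p)) - G p (nab p (A p) B) (C p).
have b_sym A B C A' B' C' : related A A' -> related B B' -> related C C' ->
    b A B C A' B' C' = b B A C B' A' C'.
  move=> [EA sA sA'] [EB sB sB'] [EC sC sC'].
  have := is_bracket_push spsi EA EB sA sB sA' sB' (torsion p A B sA sB).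
  move=> /(is_bracket_unique (torsion _ _ _ sA' sB')) T.
  have := congr1 (fun v => G (psi p) v (C' (psi p))) T.
  rewrite /b [in RHS]EC Gpsi (linear_predB (met_linear_l G _)).
  rewrite (linear_predB (met_linear_l G _)) => {}T; lra.
have b_skew A B C A' B' C' : related A A' -> related B B' -> related C C' ->
    b A B C A' B' C' + b A C B A' C' B' = 0.
  move=> [EA sA sA'] [EB sB sB'] [EC sC sC'].
  have := vder_comp (A p) spsi (met_smooth G sB' sC').
  rewrite -EA (compat _ _ _ _ sB' sC') (_ : _ \o psi = fun q => G q (B q) (C q)).
    rewrite (compat _ _ _ _ sB sC) /b.
    rewrite (met_sym _ (B p)) (met_sym _ (B' (psi p))); lra.
  by apply: functional_extensionality_dep => q /=; rewrite EB EC Gpsi.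
move=> v; apply: (@met_inj _ _ _ G) => w; have [z <-] := diffeo_dmap_surj w.
(* [b] takes fields, so the vectors [v] and [z] are extended and pushed forward; [ext_at] recovers
   them at the end. *)
have [V' [EV sV']] := isometry_push (ext v).
have [Z' [EZ sZ']] := isometry_push (ext z).
have rX : related X X' by split=> //; exact: sX'.
have rV : related (ext v) V' by split=> //; [exact: smooth_ext|exact/sV'/smooth_ext].
have rZ : related (ext z) Z' by split=> //; [exact: smooth_ext|exact/sZ'/smooth_ext].
have s1 := b_sym _ _ _ _ _ _ rV rX rZ; have k1 := b_skew _ _ _ _ _ _ rV rX rZ.
have s2 := b_sym _ _ _ _ _ _ rV rZ rX; have k2 := b_skew _ _ _ _ _ _ rZ rV rX.
have s3 := b_sym _ _ _ _ _ _ rZ rX rV; have k3 := b_skew _ _ _ _ _ _ rX rZ rV.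
(* Alternating the relations s1, k3, s3, k2, s2, k1 gives [VXZ = XVZ = -XZV = -ZXV = ZVX = VZX =
   -VXZ]. *)
have : b (ext v) X (ext z) V' X' Z' = 0 by lra.
by rewrite /b EV EZ !ext_at Gpsi => /subr0_eq.
Qed.

End Isometries.

(** * Fundamental field and bundle automorphisms *)

Section Sharp.
Variables (R : realType) (n : nat) (N : manifold R n) (G : metric N).

Definition gram p : 'M[R]_n := \matrix_(i, j) G p (tbasis p i) (tbasis p j).

(** A kernel row of the Gram matrix is itself a tangent vector pairing to zero with the basis, which
    nondegeneracy forbids unless it vanishes. *)
Lemma gram_unit p : gram p \in unitmx.
Proof.
rewrite unitmxE unitfE; apply/negP => /det0P[u u0 uG]; move/eqP: u0; apply.
apply: (@met_nondeg _ _ _ G p) => w; rewrite [w]row_sum_delta.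
rewrite (linear_pred_sum (met_linear G u)) big1 // => j _.
rewrite (linear_predZ (met_linear G u)).
have := congr1 (fun A : 'rV[R]_n => A 0 j) uG; rewrite !mxE => E.
rewrite [u in G p u _](row_sum_delta u) (linear_pred_sum (met_linear_l G _)).
under eq_bigr do rewrite (linear_predZ (met_linear_l G _)).
rewrite (_ : \sum_(i < n) _ = 0) ?scaler0 // -[RHS]E.
by apply: eq_bigr => i _; rewrite mxE.
Qed.

(** Written so that [grad] is an instance by conversion; [em_source_sharp] brings the
    electromagnetic source to the same shape, and one naturality result serves both. *)
Definition sharp p (alpha : tangent N p -> R) : tangent N p :=
  \sum_(i < n) \sum_(j < n) (ginv G p i j * alpha (tbasis p i)) *: tbasis p j.

Lemma sharpP p (alpha : tangent N p -> R) (w : tangent N p) :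
  linear (alpha : _ -> R^o) -> G p (sharp alpha) w = alpha w.
Proof.
move=> la; rewrite [w]row_sum_delta (linear_pred_sum (met_linear G _)).
rewrite (linear_pred_sum la); apply: eq_bigr => k _.
rewrite (linear_predZ (met_linear G _)) (linear_predZ la); congr (_ *: _).
have dE i : (delta_mx 0 i : 'rV[R]_n) = tbasis p i by [].
rewrite dE (linear_pred_sum (met_linear_l G _)).
transitivity (\sum_(i < n) alpha (tbasis p i) * (invmx (gram p) *m gram p) i k).
  apply: eq_bigr => i _; rewrite (linear_pred_sum (met_linear_l G _)) mxE mulr_sumr.
  apply: eq_bigr => j _; rewrite (linear_predZ (met_linear_l G _)) [gram p j k]mxE.
  by rewrite mulrCA mulrA.
rewrite mulVmx ?gram_unit // (bigD1 k) //= big1 ?addr0 => [|i ik].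
  by rewrite mxE eqxx mulr1.
by rewrite mxE (negbTE ik) mulr0.
Qed.

(** The entries of [ginv] at [p] and at [psi p] differ in general. [sharpP] replaces them by a
    basis-free characterization, which an isometry preserves. *)
Lemma sharp_natural (psi : N -> N) p (alpha : tangent N p -> R)
    (alpha' : tangent N (psi p) -> R) : Defs.isometry G psi ->
  linear (alpha : _ -> R^o) -> linear (alpha' : _ -> R^o) ->
  (forall v, alpha' (dmap psi v) = alpha v) ->
  sharp alpha' = dmap psi (sharp alpha).
Proof.
move=> isom la la' E; apply: (@met_inj _ _ _ G) => w.
have [v <-] := diffeo_dmap_surj isom w; have [_ Gpsi] := isom.
by rewrite sharpP // E Gpsi sharpP.
Qed.

End Sharp.

Section FundamentalFieldTensor.
Variables (R : realType) (n : nat) (N : manifold R n) (r : nat).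
Variables (Xi : em_structure N r).
Let J := em_J Xi.
Let D := du_conn Xi.

(* Tensoriality: the terms containing derivatives of [c i] cancel. *)
Lemma Theta_comb (I : Type) (s : seq I) p (v : tangent N p) (c : I -> N -> R)
    (e : I -> forall q, Xi q) (xi : forall q, Xi q) :
  (forall i, smooth_real_at p (c i)) -> (forall i, smooth_section_at p (e i)) ->
  (\forall q \near p, xi q = \sum_(i <- s) c i q *: e i q) ->
  D p v (fun q => J q (xi q)) - J p (D p v xi) =
  \sum_(i <- s) c i p *: (D p v (fun q => J q (e i q)) - J p (D p v (e i))).
Proof.
move=> sc se E.
have JE : \forall q \near p, J q (xi q) = \sum_(i <- s) c i q *: J q (e i q).
  apply: filterS E => q ->; rewrite (linear_pred_sum (@tam_linear _ _ _ _ _ J _)).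
  by apply: eq_bigr => i _; rewrite (linear_predZ (@tam_linear _ _ _ _ _ J _)).
rewrite (cov_comb D v sc (fun i => tam_smooth J (se i)) JE) (cov_comb D v sc se E).
rewrite (linear_pred_sum (@tam_linear _ _ _ _ _ J _)) -sumrB; apply: eq_bigr => i _.
rewrite (linear_predD (@tam_linear _ _ _ _ _ J _)) !(linear_predZ (@tam_linear _ _ _ _ _ J _)).
by rewrite opprD addrACA subrr add0r -scalerBr.
Qed.

(** By [Theta_comb] both sides depend only on frame coefficients at [p], where [ext (xi p)] and [xi]
    agree. This is needed because a bundle map does not carry an [ext] section to an [ext]
    section. *)
Lemma Theta_section p (v : tangent N p) (xi : forall q, Xi q) :
  smooth_section_at p xi ->
  Theta v (xi p) = D p v (fun q => J q (xi q)) - J p (D p v xi).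
Proof.
move=> sxi; have sext := smooth_ext (xi p).
have sf a := smooth_frame_at Xi p a.
rewrite /Theta (Theta_comb v (fun a => smooth_section_coord a sext) sf
  (near_frame_expand _ _)).
rewrite (Theta_comb v (fun a => smooth_section_coord a sxi) sf
  (near_frame_expand _ _)).
by rewrite ext_at.
Qed.

Lemma Theta_linear p (s : Xi p) : linear (fun v : tangent N p => Theta v s).
Proof.
move=> a u v; rewrite /Theta.
have lJ := cov_linear D (tam_smooth J (smooth_ext s)).
have l := cov_linear D (smooth_ext s).
rewrite (linear_predD lJ) (linear_predZ lJ) (linear_predD l) (linear_predZ l).
rewrite (linear_predD (@tam_linear _ _ _ _ _ J _)) (linear_predZ (@tam_linear _ _ _ _ _ J _)).
by rewrite opprD addrACA scalerBr.
Qed.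

End FundamentalFieldTensor.

(** * From smoothness on the total space to smoothness of sections *)

Section TotalSpaceMaps.
Variables (R : realType) (n : nat) (N : manifold R n) (r : nat) (S : vbundle N r).

Lemma total_coordK (c : chart R N n) (t : trivialization S r) (z : total_space S) :
  atlas c -> trivs t -> total_dom c t z -> total_point c t (total_coord c t z) = z.
Proof.
case: z => p s ac tS [/= cp tp]; rewrite /total_point /total_coord /=.
by rewrite row_mxKl row_mxKr (chartK ac cp) (triv_valK tS tp).
Qed.

(** In bundle charts [F] is composed with the coordinates of [z], and the last [r] entries are read
    off. [total_smooth] speaks only of points landing in the target chart; continuity of the base
    part ensures that all nearby points do. *)
Lemma total_smooth_along m (M : manifold R m) (F : total_space S -> total_space S)
    (z : M -> total_space S) x (t : trivialization S r) :
  total_smooth F ->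
  smooth_map (fun y => projT1 (z y)) ->
  smooth_along_at (phi := fun y => projT1 (z y)) x (fun y => projT2 (z y)) ->
  continuous (fun y => projT1 (F (z y))) ->
  trivs t -> triv_dom t (projT1 (F (z x))) ->
  smooth_at x (fun y => triv_val t (projT2 (F (z y)))).
Proof.
move=> sF sz [s [sS sx ss]] cF tS tx.
have [c [ac cx]] := atlas_cover (projT1 (z x)).
have [d [ad dx]] := atlas_cover (projT1 (F (z x))).
have near_src : \forall y \near x, total_dom c s (z y).
  have H1 := near_preimage sz.1 (near_cdom ac cx).
  have H2 := near_preimage sz.1 (near_triv_dom sS sx).
  by apply: filterS2 H1 H2 => y cy sy.
have near_tgt : \forall y \near x, total_dom d t (F (z y)).
  have H1 := near_preimage cF (near_cdom ad dx).
  have H2 := near_preimage cF (near_triv_dom tS tx).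
  by apply: filterS2 H1 H2 => y cy sy.
have sco : smooth_at x (fun y => total_coord c s (z y)).
  apply: smooth_at_row => j; rewrite -(splitK j); case: (fintype.split j) => i /=.
    have := smooth_at_coord i (smooth_map_chart sz ac cx).
    by apply: eq_smooth_at; apply: filterE => y; rewrite /total_coord row_mxEl.
  have := smooth_at_coord i ss.
  by apply: eq_smooth_at; apply: filterE => y; rewrite /total_coord row_mxEr.
have sFz : smooth_at x (fun y => total_coord d t (F (z y))).
  have [b [ab bx sb]] := sco.
  have H : smooth_at x ((total_coord d t \o F \o total_point c s) \o
      (fun y => total_coord c s (z y))).
    exists b; split=> //.
    apply: (smooth_near_comp_on sb _ (sF c s d t ac sS ad tS)).
    have H1 := near_cinv ab bx near_src; have H2 := near_cinv ab bx near_tgt.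
    by apply: filterS2 H1 H2 => u zu Fu; exists (z (cinv b u)).
  apply: eq_smooth_at H; apply: filterS near_src => y zy /=.
  by rewrite total_coordK.
apply: smooth_at_row => j.
apply: eq_smooth_at (smooth_at_coord (rshift n j) sFz).
by apply: filterE => y; rewrite /total_coord row_mxEr.
Qed.

End TotalSpaceMaps.

Section FormPairing.
Variables (R : realType) (M : manifold R 4) (g : metric M) (x : M) (E : lmodType R).
Implicit Types (Q : E -> E -> R) (F H : tangent M x -> tangent M x -> E).

Lemma form_pairing_linear Q F H H' a : (forall s, linear (Q s : _ -> R^o)) ->
  form_pairing g Q F (fun v w => a *: H v w + H' v w) =
  a * form_pairing g Q F H + form_pairing g Q F H'.
Proof.
move=> lQ; rewrite /form_pairing mulrCA -mulrDr; congr (_ * _).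
do 4![rewrite mulr_sumr -big_split /=; apply: eq_bigr => ? _].
by rewrite (linear_predD (lQ _)) (linear_predZ (lQ _)) mulrDr mulrCA.
Qed.

Lemma form_pairing_sum (I : Type) (s : seq I) Q F (a : I -> R)
    (H : I -> tangent M x -> tangent M x -> E) : (forall s, linear (Q s : _ -> R^o)) ->
  form_pairing g Q F (fun v w => \sum_(i <- s) a i *: H i v w) =
  \sum_(i <- s) a i * form_pairing g Q F (H i).
Proof.
move=> lQ; elim: s => [|i s IH].
  rewrite big_nil; set z := LHS.
  have : z = z + z; last by move=> zz; apply: (addrI z); rewrite -zz addr0.
  rewrite -[X in X + z]mul1r /z -form_pairing_linear //.
  congr form_pairing; apply/funext => v; apply/funext => w.
  by rewrite big_nil scaler0 addr0.
rewrite big_cons -IH -form_pairing_linear //.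
by congr form_pairing; apply/funext => v; apply/funext => w; rewrite big_cons.
Qed.

(** The coefficients involve only [g] and the volume form, so the Hodge operator does not see the
    value space. *)
Lemma hodge_linear (o : orientation M) (E' : lmodType R) (L : E -> E') F v w :
  linear L -> hodge o g (fun v w => L (F v w)) v w = L (hodge o g F v w).
Proof.
move=> lL; rewrite /hodge (linear_predZ lL); congr (_ *: _).
do 4![rewrite (linear_pred_sum lL); apply: eq_bigr => ? _].
by rewrite (linear_predZ lL).
Qed.

End FormPairing.

Section BundleAutomorphisms.
Variables (R : realType) (n : nat) (N : manifold R n) (r : nat) (S : vbundle N r).
Variable (f : unbased_aut S).

Let total (z : total_space S) : total_space S :=
  existT _ (ub_base f (projT1 z)) (f (projT1 z) (projT2 z)).

Lemma existT_inj p (s s' : S p) :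
  existT (fun q => S q : Type) p s = existT _ p s' -> s = s'.
Proof.
move=> E; have H (z z' : total_space S) : z = z' -> forall e : projT1 z = projT1 z',
    eq_rect _ (fun q => S q : Type) (projT2 z) _ e = projT2 z'.
  by move=> -> e; rewrite (eq_irrelevance e erefl).
exact: (H _ _ E erefl).
Qed.

Lemma ub_base_inv : exists chi : N -> N,
  [/\ cancel (ub_base f) chi, cancel chi (ub_base f) & smooth_map chi].
Proof. by have [_] := ub_base_diffeo f. Qed.

Lemma ub_base_smooth : smooth_map (ub_base f).
Proof. by have [] := ub_base_diffeo f. Qed.

Lemma ub_inj p : injective (ub_map f (p := p)).
Proof.
move=> s s' E; have [F' [FK _ _ _]] := ub_total f.
have : total (existT _ p s) = total (existT _ p s') by rewrite /total /= E.
by move=> /(can_inj FK)/existT_inj.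
Qed.

(** The inverse total map yields a preimage over some [q]; injectivity of the base map forces
    [q = p]. *)
Lemma ub_surj p (w : S (ub_base f p)) : exists s : S p, f p s = w.
Proof.
have [F' [_ F'K _ _]] := ub_total f; have [chi [psiK _ _]] := ub_base_inv.
have := F'K (existT _ (ub_base f p) w).
case: (F' _) => q s /= E; have pq : q = p.
  by apply: (can_inj psiK); exact: (congr1 (fun z => projT1 z) E).
by subst q; exists s; exact: existT_inj E.
Qed.

(** Pushing forward uses smoothness of the total map; the implication back to [sigma] applies the
    same argument to its inverse [F']. *)
Lemma ub_smooth_along m (M : manifold R m) (phi : M -> N)
    (sigma : forall y, S (phi y)) x : smooth_map phi ->
  smooth_along_at (phi := ub_base f \o phi) x (fun y => f (phi y) (sigma y)) <->
  smooth_along_at x sigma.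
Proof.
move=> sphi; have [F' [FK _ sF sF']] := ub_total f.
have spsi := smooth_map_comp sphi ub_base_smooth.
split=> ss.
  have [t [tS tx]] := triv_cover S (phi x); exists t; split=> //.
  pose z y : total_space S := existT _ (ub_base f (phi y)) (f (phi y) (sigma y)).
  have E y : F' (z y) = existT _ (phi y) (sigma y) := FK (existT _ (phi y) (sigma y)).
  have : smooth_at x (fun y => triv_val t (projT2 (F' (z y)))).
    apply: total_smooth_along => //; last by rewrite E.
    rewrite (_ : (fun y => _) = phi); first exact: sphi.1.
    by apply/funext => y; rewrite E.
  by apply: eq_smooth_at; apply: filterE => y; rewrite E.
have [t [tS tx]] := triv_cover S (ub_base f (phi x)); exists t; split=> //.
pose z y : total_space S := existT _ (phi y) (sigma y).
apply: (total_smooth_along (z := z) sF) => //; exact: spsi.1.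
Qed.

Lemma ub_push (xi : forall q, S q) :
  exists eta : forall q, S q, (forall q, eta (ub_base f q) = f q (xi q)) /\
    (forall p, smooth_section_at p xi -> smooth_section_at (ub_base f p) eta).
Proof.
have [chi [psiK chiK schi]] := ub_base_inv.
have [eta [E seta]] := push_section (fun p => ub_map f (p := p)) xi psiK chiK schi.
exists eta; split=> // p sxi; apply: seta.
exact: (ub_smooth_along (phi := fun q => q) xi p (smooth_map_id N)).2.
Qed.

End BundleAutomorphisms.

Section EMAutomorphisms.
Variables (R : realType) (n r : nat) (N : manifold R n) (Xi : em_structure N r).
Variables (f : unbased_aut Xi) (aut : em_aut f).
Let J := em_J Xi.

Lemma em_aut_intertwines :
  intertwines (du_conn Xi) (du_conn Xi) (fun p => ub_map f (p := p)).
Proof.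
move=> p xi sxi; have [eta [E seta]] := ub_push f xi.
exists eta; split=> // [|v]; first exact: seta.
by have [_ _ H] := aut; exact: (H p v xi eta sxi E).
Qed.

(** As [f] commutes with [J], the section [J eta] is the push-forward of [J (ext s)], so covariant
    constancy applies to both terms of [Theta]. *)
Lemma Theta_natural p (v : tangent N p) (s : Xi p) :
  Theta (dmap (ub_base f) v) (f p s) = f p (Theta v s).
Proof.
have [_ fJ fD] := aut; have [eta [E seta]] := ub_push f (ext s).
have sx := smooth_ext s.
rewrite -{1}(ext_at s) -E (Theta_section _ (seta p sx)).
rewrite (fD _ v _ _ sx E) (fD _ v (fun q => J q (ext s q)) (fun q => J q (eta q))).
- by rewrite -fJ -(linear_predB (ub_linear f (p := p))).
- exact: tam_smooth.
- by move=> q; rewrite E fJ.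
Qed.

Lemma Qform_natural p (s s' : Xi p) : Qform (f p s) (f p s') = Qform s s'.
Proof. by have [fw fJ _] := aut; rewrite /Qform -fJ fw. Qed.

End EMAutomorphisms.

(** * Symmetries of the equations *)

Section SolutionSymmetries.
Variables (R : realType) (M : manifold R 4) (o : orientation M) (g : metric M).
Variables (n r : nat) (DD : scalar_em_structure R n r).
Variables (nabM : connection (tangent M)) (nabN : connection (tangent (sc_mfd DD))).
Hypothesis hN : levi_civita (sc_met DD) nabN.
Variables (f : unbased_aut (se_em DD)) (fA : Aut_sem DD f).
Variables (phi : M -> sc_mfd DD) (V : vtensor phi).

Let N := sc_mfd DD.
Let psi := ub_base f.
Let aut : em_aut f := fA.1.
Let isom : Defs.isometry (sc_met DD) psi := fA.2.1.
Let spsi : smooth_map psi := isometry_smooth isom.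
Let fl p : linear (ub_map f (p := p)) := @ub_linear _ _ _ _ _ f p.
Let dl p : linear (fun v : tangent N p => dmap psi v) := @dmap_linear _ _ _ _ _ psi p.
Let push : vtensor (psi \o phi) := fun x v w => f (phi x) (V v w).

Lemma twisted_d_natural x (u v w : tangent M x) : smooth_map phi -> is_two_form V ->
  twisted_d push u v w = f (phi x) (twisted_d V u v w).
Proof.
move=> sphi [_ _ sV]; have nat := pullback_cov_natural _ fl (em_aut_intertwines aut) sphi spsi.
rewrite /twisted_d (linear_predD (@fl _)) (linear_predB (@fl _)).
(* The extensions of [u], [v], [w] live on [M] and are the same on both sides; only the pull-back
   connection changes. *)
by congr (_ - _ + _); apply: nat; apply: sV; exact: smooth_ext.
Qed.

Lemma second_fundamental_natural x (v w : tangent M x) : smooth_map phi ->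
  second_fundamental nabM nabN (psi \o phi) v w =
  dmap psi (second_fundamental nabM nabN phi v w).
Proof.
move=> sphi; rewrite /second_fundamental (linear_predB (@dl _)).
rewrite -(dmap_comp _ sphi spsi); congr (_ - _).
rewrite -(pullback_cov_natural v dl (levi_civita_natural isom hN) sphi spsi).
  congr (pullback_cov _ _ _); apply: functional_extensionality_dep => y.
  exact: dmap_comp.
by apply: dmap_smooth => //; exact: smooth_ext.
Qed.

Lemma grad_natural p : grad (sc_met DD) (sc_pot (s := DD)) (psi p) =
  dmap psi (grad (sc_met DD) (sc_pot (s := DD)) p).
Proof.
have [_ pot] := fA.2.
apply: (sharp_natural isom (vder_linear _) (vder_linear _)) => v.
rewrite -(vder_comp v spsi (sc_smooth _)).
by congr (vder v _); apply/funext => q; exact: pot.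
Qed.

Lemma theta_Sigma_natural x : smooth_map phi ->
  theta_Sigma g nabM nabN (psi \o phi) x = dmap psi (theta_Sigma g nabM nabN phi x).
Proof.
move=> sphi; rewrite /theta_Sigma (linear_predB (@dl _)) grad_natural.
congr (_ - _); do 2![rewrite (linear_pred_sum (@dl _)); apply: eq_bigr => ? _].
by rewrite second_fundamental_natural // (linear_predZ (@dl _)).
Qed.

(** [Qform] is linear in its second slot, so the inverse metric inside [Psi] comes out of the
    pairing. A general [rho] lets it serve both [phi] and [psi \o phi]. *)
Lemma em_source_sharp (rho : M -> N) (H : vtensor rho) x : em_source o g H x =
  sharp (sc_met DD) (fun w => form_pairing g (@Qform _ _ _ _ (se_em DD) (rho x))
    (hodge o g (H x)) (fun u v => Theta w (H x u v))).
Proof.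
rewrite /em_source /sharp exchange_big /=; apply: eq_bigr => j _.
rewrite /Psi form_pairing_sum ?scaler_suml // => s; exact: du_linear.
Qed.

Lemma em_source_natural x : em_source o g push x = dmap psi (em_source o g V x).
Proof.
rewrite !em_source_sharp; apply: (sharp_natural isom).
- move=> a u v; rewrite -form_pairing_linear => [|s]; last exact: du_linear.
  congr form_pairing; apply/funext => w; apply/funext => w'; exact: Theta_linear.
- move=> a u v; rewrite -form_pairing_linear => [|s]; last exact: du_linear.
  congr form_pairing; apply/funext => w; apply/funext => w'; exact: Theta_linear.
- move=> v; rewrite /form_pairing; congr (_ * _).
  do 4![apply: eq_bigr => ? _]; congr (_ * _).
  by rewrite (hodge_linear _ _ _ _ _ (@fl _)) Theta_natural // Qform_natural.
Qed.

Lemma is_sol_push : smooth_map phi -> is_two_form V ->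
  is_sol o g nabM nabN push <-> is_sol o g nabM nabN V.
Proof.
move=> sphi V2; rewrite /is_sol.
have E1 x : theta_Sigma g nabM nabN (psi \o phi) x - 2^-1 *: em_source o g push x =
    dmap psi (theta_Sigma g nabM nabN phi x - 2^-1 *: em_source o g V x).
  rewrite theta_Sigma_natural // em_source_natural.
  by rewrite [RHS](linear_predB (@dl _)) (linear_predZ (@dl _)).
split=> -[H1 H2]; split=> [x|x u v w].
- apply: (diffeo_dmap_inj isom); rewrite -E1 H1.
  by rewrite (linear_pred0 (@dl _)).
- apply: (@ub_inj _ _ _ _ _ f).
  by rewrite -twisted_d_natural // H2 (linear_pred0 (@fl _)).
- by rewrite E1 H1 (linear_pred0 (@dl _)).
- by rewrite twisted_d_natural // H2 (linear_pred0 (@fl _)).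
Qed.

(** No regularity of [phi] is assumed: in the converse it is recovered by composing [psi \o phi]
    with [chi]. Algebraic conditions are reflected by fibrewise injectivity, smoothness of [V] by
    [ub_smooth_along]. *)
Lemma is_conf_push : is_conf o g push <-> is_conf o g V.
Proof.
have [chi [psiK _ schi]] := ub_base_inv f; have [_ fJ _] := aut.
have hodge_push x v w : hodge o g (@push x) v w = f (phi x) (hodge o g (@V x) v w).
  exact: (hodge_linear g o (@V x) v w (@fl _)).
split=> -[sp [lV aV sV] hV]; last first.
  split; first exact: smooth_map_comp.
    split=> [x v a u w|x v w|x X Y sX sY].
    - by rewrite /push lV fl.
    - by rewrite /push aV (linear_predN (@fl _)).
    - exact/ub_smooth_along/sV.
  by move=> x v w; rewrite hodge_push hV (linear_predN (@fl _)) fJ.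
have sphi : smooth_map phi.
  have := smooth_map_comp sp schi; congr smooth_map.
  by apply/funext => y; exact: psiK.
split=> //.
  split=> [x v a u w|x v w|x X Y sX sY].
  - by apply: (@ub_inj _ _ _ _ _ f); rewrite fl; exact: lV.
  - by apply: (@ub_inj _ _ _ _ _ f); rewrite (linear_predN (@fl _)); exact: aV.
  - by apply/(ub_smooth_along f _ _ sphi); exact: sV.
move=> x v w; apply: (@ub_inj _ _ _ _ _ f).
by rewrite -hodge_push hV (linear_predN (@fl _)) fJ.
Qed.

Lemma Sol_push : Sol o g nabM nabN (existT _ (psi \o phi) push) <->
  Sol o g nabM nabN (existT _ phi V).
Proof.
split=> -[/= cV sV].
  have cV' := is_conf_push.1 cV; split=> //=.
  by have [sphi V2 _] := cV'; exact: (is_sol_push sphi V2).1.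
split=> /=; first exact: is_conf_push.2.
by have [sphi V2 _] := cV; exact: (is_sol_push sphi V2).2.
Qed.

End SolutionSymmetries.

Theorem corollary3p17 (R : realType) (M : manifold R 4) (o : orientation M)
    (g : metric M) (hg : lorentzian g)
    (n r : nat) (DD : scalar_em_structure R n r)
    (nabM : connection (tangent M)) (hM : levi_civita g nabM)
    (nabN : connection (tangent (sc_mfd DD)))
    (hN : levi_civita (sc_met DD) nabN)
    (f : unbased_aut (se_em DD)) :
  Aut_sem DD f ->
  diamond f @` Sol o g nabM nabN = Sol o g nabM nabN.
Proof.
move=> fA; apply/seteqP; split=> [_ [[phi V] sV <-]|[phi' V'] sV'].
  exact: (Sol_push o g nabM hN fA V).2.
have [chi [_ chiK _]] := ub_base_inv f.
(* Substituting this factorization makes each [V' x v w] an element of the fiber over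
   [ub_base f (phi x)], so [ub_surj] applies without transport. *)
have E : phi' = ub_base f \o (chi \o phi') by apply/funext => y /=; rewrite chiK.
move: (chi \o phi') E => phi E; subst phi'.
(* Preimages are chosen value by value, with no regularity to check: [Sol_push] deduces it from that
   of [V']. *)
pose V : vtensor phi := fun x v w => sval (cid (ub_surj (V' x v w))).
have E : V' = fun x v w => f (phi x) (V x v w).
  apply: functional_extensionality_dep => x; apply/funext => v; apply/funext => w.
  by rewrite /V; case: cid.
exists (existT _ phi V); last by rewrite /diamond /= E.
by apply: (Sol_push o g nabM hN fA V).1; rewrite E in sV'.
Qed.
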